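(* The system $\mathrm{RCA}_0^\omega+\mathrm{MCT}^0_{\mathrm{net}}$ proves $\mathrm{HBU}$. Here $\mathrm{MCT}^0_{\mathrm{net}}$ (the monotone convergence theorem for nets) is the statement that every increasing net in $[0,1]$ indexed by a subset of Baire space converges, and $\mathrm{HBU}$ is the statement that for every $\Psi:\mathbb{R}\to\mathbb{R}^+$ there are finitely many $y_1,\dots,y_k\in[0,1]$ such that $(\forall x\in[0,1])(\exists i\le k)\big(x\in(y_i-\Psi(y_i),y_i+\Psi(y_i))\big)$.
   Context: Base theory. Finite types: $0$ (natural numbers) is a type, and if $\sigma,\tau$ are types then so is $\sigma\to\tau$ (mappings from type $\sigma$ to type $\tau$ objects); $1:=0\to0$ and $n+1:=n\to0$; a superscript on a variable is its type. $L_\omega$ is the language with variables and quantifiers of all finite types, constants $0,1,<_0,+_0,\times_0,=_0$ on $\mathbb{N}$, the combinators $\Pi,\Sigma$ and a recursor constant $\mathbf{R}_0$. Equality at higher types is defined extensionally: $x=_\tau y$ iff $xz_1\dots z_k=_0yz_1\dots z_k$ for all arguments. $\mathrm{QF\text{-}AC}^{\sigma,\tau}$ is the schema $(\forall x^\sigma)(\exists y^\tau)A(x,y)\to(\exists Y^{\sigma\to\tau})(\forall x^\sigma)A(x,Y(x))$ for quantifier-free $A$ of $L_\omega$ (parameters of any type allowed). $\mathrm{RCA}_0^\omega$ is the theory in $L_\omega$ with classical logic and the axioms: $\mathbb{N}$ is an ordered semi-ring; the defining axioms of $\Pi,\Sigma$ (giving $\lambda$-abstraction); $\mathbf{R}_0(f,m,0)=m$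 and $\mathbf{R}_0(f,m,n+1)=f(n,\mathbf{R}_0(f,m,n))$; extensionality $x=_\rho y\to\varphi(x)=_\tau\varphi(y)$ for all types $\rho,\tau$ and $\varphi^{\rho\to\tau}$; induction for quantifier-free formulas of $L_\omega$; $\mathrm{QF\text{-}AC}^{1,0}$. Reals. A real is a sequence of rationals $(q_n)$ with $|q_n-q_{n+i}|<2^{-n}$ for all $n,i$ (a type 1 object); $(q_n)=_{\mathbb{R}}(r_n)$ iff $|q_n-r_n|\le2^{-n+1}$ for all $n$. A function $\mathbb{R}\to\mathbb{R}$ is a type $1\to1$ functional mapping equal reals to equal reals. Sets. A subset $D$ of Baire space $\mathbb{N}^{\mathbb{N}}$ is given by a characteristic function $F_D^2\le1$ ($f\in D$ means $F_D(f)=1$); a binary relation $\preceq$ on $D$ is likewise given by a characteristic function of type $(1\times1)\to0$. Via coding (and extensionality with respect to $=_{\mathbb{R}}$), subsets of $\mathbb{R}$ and sets of finite sequences of reals, and relations on them, are included. Nets. $(D,\preceq)$ with $D\neq\emptyset$ is directed if $\preceq$ is transitive and reflexive on $D$ and for all $x,y\in D$ there is $z\in D$ with $x\preceq z$ and $y\preceq z$. A net in $X\subseteq\mathbb{R}$ is a map $x_d:D\to X$ with $(D,\preceq)$ directed; all index sets are subsets of Baire space given by characteristic functions $F_D^2\le1$, with $\preceq$ given by a characteristic function of type $(1\times1)\to0$ (including, via coding, subsets of $\mathbb{R}$ and sets of finite sequences of reals). The net $x_d$ is increasing if $a\preceq b$ implies $x_a\le_{\mathbb{R}}x_b$ for all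 $a,b\in D$. It converges to $y$ if $(\forall\varepsilon>0)(\exists d_0\in D)(\forall e\succeq d_0)(|x_e-y|<\varepsilon)$. *)

(* Defs.v *)
From Stdlib Require List.
From mathcomp Require Import ssreflect ssrfun ssrbool eqtype ssrnat seq.

Set Implicit Arguments.
Unset Strict Implicit.
Unset Printing Implicit Defensive.

(* Terms and formulas of L_omega are intrinsically typed, with de Bruijn
   variables: the context [G] of a term or formula lists the types of its free
   variables, innermost first. *)

Inductive ty : Type :=
| tp0 : ty
| Arr : ty -> ty -> ty.

Declare Scope ty_scope.
Delimit Scope ty_scope with ty.
Bind Scope ty_scope with ty.
Notation "s ~> t" := (Arr s t) (at level 55, right associativity) : ty_scope.
Notation tp1 := (Arr tp0 tp0).
Notation tp2 := (Arr tp1 tp0).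

Definition ctx := seq ty.

Inductive var : ctx -> ty -> Type :=
| VZ G s : var (s :: G) s
| VS G s t : var G s -> var (t :: G) s.

Inductive tm (G : ctx) : ty -> Type :=
| Var s : var G s -> tm G s
| App s t : tm G (s ~> t) -> tm G s -> tm G t
| Zero : tm G tp0
| One : tm G tp0
| Plus : tm G (tp0 ~> tp0 ~> tp0)
| Times : tm G (tp0 ~> tp0 ~> tp0)
| Pi s t : tm G (s ~> t ~> s)
| Sigma r s t : tm G ((r ~> s ~> t) ~> (r ~> s) ~> r ~> t)
| Rec : tm G ((tp0 ~> tp0 ~> tp0) ~> tp0 ~> tp0 ~> tp0).

Arguments Zero {G}.
Arguments One {G}.
Arguments Plus {G}.
Arguments Times {G}.
Arguments Pi {G} s t.
Arguments Sigma {G} r s t.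
Arguments Rec {G}.

Inductive fm (G : ctx) : Type :=
| Eq0 : tm G tp0 -> tm G tp0 -> fm G
| Lt0 : tm G tp0 -> tm G tp0 -> fm G
| Bot : fm G
| And : fm G -> fm G -> fm G
| Or : fm G -> fm G -> fm G
| Imp : fm G -> fm G -> fm G
| All s : fm (s :: G) -> fm G
| Ex s : fm (s :: G) -> fm G.

Arguments Bot {G}.
Arguments All {G} s _.
Arguments Ex {G} s _.

Declare Scope L_scope.
Delimit Scope L_scope with L.
Bind Scope L_scope with tm.
Bind Scope L_scope with fm.
Local Open Scope L_scope.

Notation "f `@ x" := (App f x) (at level 38, left associativity) : L_scope.
Notation "0" := Zero : L_scope.
Notation "1" := One : L_scope.
Notation "2" := (App (App Plus One) One) : L_scope.
Notation "x + y" := (App (App Plus x) y) : L_scope.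
Notation "x * y" := (App (App Times x) y) : L_scope.

Notation "x `= y" := (Eq0 x y) (at level 70, no associativity) : L_scope.
Notation "x `< y" := (Lt0 x y) (at level 70, no associativity) : L_scope.
Notation "x `<= y" := (Or (Lt0 x y) (Eq0 x y))
  (at level 70, no associativity) : L_scope.
Notation "`~ A" := (Imp A Bot) (at level 75, right associativity) : L_scope.
Notation "A `/\ B" := (And A B) (at level 80, right associativity) : L_scope.
Notation "A `\/ B" := (Or A B) (at level 85, right associativity) : L_scope.
Notation "A `-> B" := (Imp A B)
  (at level 99, right associativity, B at level 200) : L_scope.

Fixpoint qf G (A : fm G) : bool :=
  match A with
  | Eq0 _ _ | Lt0 _ _ | Bot => true
  | And A B | Or A B | Imp A B => qf A && qf B
  | All _ _ | Ex _ _ => false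
  end.

Notation v0 := (Var (VZ _ _)).
Notation v1 := (Var (VS _ (VZ _ _))).
Notation v2 := (Var (VS _ (VS _ (VZ _ _)))).
Notation v3 := (Var (VS _ (VS _ (VS _ (VZ _ _))))).
Notation v4 := (Var (VS _ (VS _ (VS _ (VS _ (VZ _ _)))))).

Definition vcase t G (P : ty -> Type) (z : P t) (f : forall s, var G s -> P s)
    s (v : var (t :: G) s) : P s :=
  match v in var H u return
    match H with
    | [::] => unit
    | t' :: G' => P t' -> (forall s, var G' s -> P s) -> P u
    end
  with
  | VZ _ _ => fun z _ => z
  | VS _ _ _ w => fun _ f => f _ w
  end z f.

Definition vnil (P : ty -> Type) s (v : var [::] s) : P s :=
  match v in var H u return match H with [::] => P u | _ :: _ => unit end with
  | VZ _ _ => tt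
  | VS _ _ _ _ => tt
  end.

Definition ren (G G' : ctx) := forall s, var G s -> var G' s.

Definition up_ren G G' (r : ren G G') t : ren (t :: G) (t :: G') :=
  vcase (P := var (t :: G')) (VZ G' t) (fun s v => VS t (r s v)).

Fixpoint ren_tm G G' (r : ren G G') s (u : tm G s) : tm G' s :=
  match u with
  | Var _ v => Var (r _ v)
  | App _ _ f a => ren_tm r f `@ ren_tm r a
  | Zero => 0
  | One => 1
  | Plus => Plus
  | Times => Times
  | Pi s t => Pi s t
  | Sigma r s t => Sigma r s t
  | Rec => Rec
  end.

Fixpoint ren_fm G G' (r : ren G G') (A : fm G) : fm G' :=
  match A with
  | Eq0 a b => ren_tm r a `= ren_tm r b
  | Lt0 a b => ren_tm r a `< ren_tm r b
  | Bot => Bot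
  | And A B => ren_fm r A `/\ ren_fm r B
  | Or A B => ren_fm r A `\/ ren_fm r B
  | Imp A B => ren_fm r A `-> ren_fm r B
  | All s A => All s (ren_fm (up_ren r (t := s)) A)
  | Ex s A => Ex s (ren_fm (up_ren r (t := s)) A)
  end.

Definition wk G t s (u : tm G s) : tm (t :: G) s :=
  ren_tm (fun s v => VS t v) u.
Definition wk_fm G t (A : fm G) : fm (t :: G) := ren_fm (fun s v => VS t v) A.
Definition wk_sentence G (A : fm [::]) : fm G :=
  ren_fm (fun s v => vnil (var G) v) A.

Arguments wk {G t s} u.
Arguments wk_fm {G t} A.
Arguments wk_sentence {G} A.

Definition sub (G G' : ctx) := forall s, var G s -> tm G' s.

Definition scons G G' t (u : tm G' t) (f : sub G G') : sub (t :: G) G' :=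
  vcase (P := tm G') u f.

Definition up_sub G G' (f : sub G G') t : sub (t :: G) (t :: G') :=
  scons v0 (fun s v => wk (f s v)).

Fixpoint sub_tm G G' (f : sub G G') s (u : tm G s) : tm G' s :=
  match u with
  | Var _ v => f _ v
  | App _ _ g a => sub_tm f g `@ sub_tm f a
  | Zero => 0
  | One => 1
  | Plus => Plus
  | Times => Times
  | Pi s t => Pi s t
  | Sigma r s t => Sigma r s t
  | Rec => Rec
  end.

Fixpoint sub_fm G G' (f : sub G G') (A : fm G) : fm G' :=
  match A with
  | Eq0 a b => sub_tm f a `= sub_tm f b
  | Lt0 a b => sub_tm f a `< sub_tm f b
  | Bot => Bot
  | And A B => sub_fm f A `/\ sub_fm f B
  | Or A B => sub_fm f A `\/ sub_fm f B
  | Imp A B => sub_fm f A `-> sub_fm f B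
  | All s A => All s (sub_fm (up_sub f (t := s)) A)
  | Ex s A => Ex s (sub_fm (up_sub f (t := s)) A)
  end.

Definition inst G t (A : fm (t :: G)) (u : tm G t) : fm G :=
  sub_fm (scons u (fun s v => Var v)) A.

Definition theory := fm [::] -> Prop.

Inductive deriv (T : theory) : forall G, seq (fm G) -> fm G -> Prop :=
| d_axiom G (H : seq (fm G)) A : T A -> deriv T H (wk_sentence A)
| d_hyp G (H : seq (fm G)) A : List.In A H -> deriv T H A
| d_impI G (H : seq (fm G)) A B : deriv T (A :: H) B -> deriv T H (A `-> B)
| d_impE G (H : seq (fm G)) A B :
    deriv T H (A `-> B) -> deriv T H A -> deriv T H B
| d_andI G (H : seq (fm G)) A B :
    deriv T H A -> deriv T H B -> deriv T H (A `/\ B)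
| d_andE1 G (H : seq (fm G)) A B : deriv T H (A `/\ B) -> deriv T H A
| d_andE2 G (H : seq (fm G)) A B : deriv T H (A `/\ B) -> deriv T H B
| d_orI1 G (H : seq (fm G)) A B : deriv T H A -> deriv T H (A `\/ B)
| d_orI2 G (H : seq (fm G)) A B : deriv T H B -> deriv T H (A `\/ B)
| d_orE G (H : seq (fm G)) A B C :
    deriv T H (A `\/ B) -> deriv T (A :: H) C -> deriv T (B :: H) C ->
    deriv T H C
| d_raa G (H : seq (fm G)) A : deriv T ((`~ A) :: H) Bot -> deriv T H A
| d_allI G (H : seq (fm G)) s (A : fm (s :: G)) :
    deriv T (map wk_fm H) A -> deriv T H (All s A)
| d_allE G (H : seq (fm G)) s (A : fm (s :: G)) (u : tm G s) :
    deriv T H (All s A) -> deriv T H (inst A u)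
| d_exI G (H : seq (fm G)) s (A : fm (s :: G)) (u : tm G s) :
    deriv T H (inst A u) -> deriv T H (Ex s A)
| d_exE G (H : seq (fm G)) s (A : fm (s :: G)) C :
    deriv T H (Ex s A) -> deriv T (A :: map wk_fm H) (wk_fm C) -> deriv T H C.

Definition proves (T : theory) (A : fm [::]) : Prop := deriv T [::] A.

Definition add_axiom (T : theory) (A : fm [::]) : theory :=
  fun B => T B \/ B = A.

Fixpoint closure G : fm G -> fm [::] :=
  match G return fm G -> fm [::] with
  | [::] => fun A => A
  | s :: G' => fun A => closure (All s A)
  end.

Fixpoint eqT s : forall G, tm G s -> tm G s -> fm G :=
  match s return forall G, tm G s -> tm G s -> fm G with
  | tp0 => fun G x y => x `= y
  | Arr r t => fun G x y => All r (eqT (wk x `@ v0) (wk y `@ v0))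
  end.

(* Axioms may have parameters; [RCA0w] consists of their universal closures.
   Replacement of equals in function terms is [ax_extensionality].
   In [ax_QF_AC10], the matrix [A] has [y] as variable 0 and [x] as variable 1;
   in the conclusion [x] is variable 0 and [Y] is variable 1. *)
Inductive RCA0w_axiom : forall G, fm G -> Prop :=
| ax_eq0_refl G (x : tm G tp0) : RCA0w_axiom (x `= x)
| ax_eq0_sym G (x y : tm G tp0) : RCA0w_axiom (x `= y `-> y `= x)
| ax_eq0_trans G (x y z : tm G tp0) :
    RCA0w_axiom (x `= y `-> y `= z `-> x `= z)
| ax_lt0_congr G (x x' y y' : tm G tp0) :
    RCA0w_axiom (x `= x' `-> y `= y' `-> x `< y `-> x' `< y')
| ax_addA G (x y z : tm G tp0) : RCA0w_axiom ((x + y) + z `= x + (y + z))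
| ax_addC G (x y : tm G tp0) : RCA0w_axiom (x + y `= y + x)
| ax_add0 G (x : tm G tp0) : RCA0w_axiom (x + 0 `= x)
| ax_mulA G (x y z : tm G tp0) : RCA0w_axiom ((x * y) * z `= x * (y * z))
| ax_mulC G (x y : tm G tp0) : RCA0w_axiom (x * y `= y * x)
| ax_mul1 G (x : tm G tp0) : RCA0w_axiom (x * 1 `= x)
| ax_mul0 G (x : tm G tp0) : RCA0w_axiom (x * 0 `= 0)
| ax_mulDr G (x y z : tm G tp0) : RCA0w_axiom (x * (y + z) `= x * y + x * z)
| ax_lt_irr G (x : tm G tp0) : RCA0w_axiom (`~ x `< x)
| ax_lt_trans G (x y z : tm G tp0) :
    RCA0w_axiom (x `< y `-> y `< z `-> x `< z)
| ax_lt_total G (x y : tm G tp0) : RCA0w_axiom (x `< y `\/ x `= y `\/ y `< x)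
| ax_lt_add G (x y z : tm G tp0) : RCA0w_axiom (x `< y `-> x + z `< y + z)
| ax_lt_mul G (x y z : tm G tp0) :
    RCA0w_axiom (0 `< z `-> x `< y `-> x * z `< y * z)
| ax_lt01 G : RCA0w_axiom (0 `< 1 : fm G)
| ax_Pi_def G s t (x : tm G s) (y : tm G t) :
    RCA0w_axiom (eqT (Pi s t `@ x `@ y) x)
| ax_Sigma_def G r s t (x : tm G (r ~> s ~> t)) (y : tm G (r ~> s)) (z : tm G r) :
    RCA0w_axiom (eqT (Sigma r s t `@ x `@ y `@ z) (x `@ z `@ (y `@ z)))
| ax_Rec_0 G (f : tm G (tp0 ~> tp0 ~> tp0)) (m : tm G tp0) :
    RCA0w_axiom (Rec `@ f `@ m `@ 0 `= m)
| ax_Rec_S G (f : tm G (tp0 ~> tp0 ~> tp0)) (m n : tm G tp0) :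
    RCA0w_axiom (Rec `@ f `@ m `@ (n + 1) `= f `@ n `@ (Rec `@ f `@ m `@ n))
| ax_extensionality G r t (x y : tm G r) (f : tm G (r ~> t)) :
    RCA0w_axiom (eqT x y `-> eqT (f `@ x) (f `@ y))
| ax_QF_induction G (A : fm (tp0 :: G)) : qf A ->
    RCA0w_axiom
      (inst A 0 `->
       All tp0 (A `-> sub_fm (scons (v0 + 1) (fun s v => Var (VS tp0 v))) A) `->
       All tp0 A)
| ax_QF_AC10 G (A : fm (tp0 :: tp1 :: G)) : qf A ->
    RCA0w_axiom
      (All tp1 (Ex tp0 A) `->
       Ex tp2 (All tp1
         (sub_fm (scons (v1 `@ v0)
                    (scons v0 (fun s v => Var (VS tp1 (VS tp2 v))))) A))).

Definition RCA0w : theory :=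
  fun B => exists G (A : fm G), RCA0w_axiom A /\ B = closure A.

(* bracket abstraction *)
Fixpoint lam r G t (u : tm (r :: G) t) : tm G (r ~> t) :=
  match u in tm _ t return tm G (r ~> t) with
  | Var s v =>
      vcase (P := fun s => tm G (r ~> s))
        (Sigma r (r ~> r) r `@ Pi r (r ~> r) `@ Pi r r)
        (fun s v => Pi s r `@ Var v) v
  | App s t f a => Sigma r s t `@ lam f `@ lam a
  | Zero => Pi _ r `@ 0
  | One => Pi _ r `@ 1
  | Plus => Pi _ r `@ Plus
  | Times => Pi _ r `@ Times
  | Pi s t => Pi _ r `@ Pi s t
  | Sigma r' s t => Pi _ r `@ Sigma r' s t
  | Rec => Pi _ r `@ Rec
  end.

Definition pred0 G (x : tm G tp0) : tm G tp0 := Rec `@ lam (lam v1) `@ 0 `@ x.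

Definition monus G (x y : tm G tp0) : tm G tp0 :=
  Rec `@ lam (lam (pred0 v0)) `@ x `@ y.

(* [a] if [c] is 0, and [b] otherwise *)
Definition ifz G (c a b : tm G tp0) : tm G tp0 :=
  Rec `@ lam (lam (wk (wk b))) `@ a `@ c.

Definition exp2 G (n : tm G tp0) : tm G tp0 :=
  Rec `@ lam (lam (v0 + v0)) `@ 1 `@ n.

(* Cantor pairing: [pair x y = tri (x + y) + y] with [tri w = w (w + 1) / 2];
   [triroot n] is the largest [w] with [tri w <= n]. *)
Definition tri G (w : tm G tp0) : tm G tp0 :=
  Rec `@ lam (lam (v0 + (v1 + 1))) `@ 0 `@ w.

Definition triroot G (n : tm G tp0) : tm G tp0 :=
  Rec `@ lam (lam (ifz (monus (tri (v0 + 1)) (v1 + 1)) (v0 + 1) v0)) `@ 0 `@ n.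

Definition pair0 G (x y : tm G tp0) : tm G tp0 := tri (x + y) + y.
Definition snd0 G (n : tm G tp0) : tm G tp0 := monus n (tri (triroot n)).
Definition fst0 G (n : tm G tp0) : tm G tp0 := monus (triroot n) (snd0 n).

(* Every number is a code [pair0 (pair0 a b) c], of the rational
   (a - b) / (c + 1); codes are not unique. *)

Definition mkq G (a b c : tm G tp0) : tm G tp0 := pair0 (pair0 a b) c.
Definition qpos G (q : tm G tp0) : tm G tp0 := fst0 (fst0 q).
Definition qneg G (q : tm G tp0) : tm G tp0 := snd0 (fst0 q).
Definition qden G (q : tm G tp0) : tm G tp0 := snd0 q + 1.

Definition qlt G (p q : tm G tp0) : fm G :=
  qpos p * qden q + qneg q * qden p `< qpos q * qden p + qneg p * qden q.
Definition qle G (p q : tm G tp0) : fm G :=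
  qpos p * qden q + qneg q * qden p `<= qpos q * qden p + qneg p * qden q.

Definition qadd G (p q : tm G tp0) : tm G tp0 :=
  mkq (qpos p * qden q + qpos q * qden p)
      (qneg p * qden q + qneg q * qden p)
      (pred0 (qden p * qden q)).
Definition qsub G (p q : tm G tp0) : tm G tp0 :=
  qadd p (mkq (qneg q) (qpos q) (snd0 q)).
Definition qabs G (q : tm G tp0) : tm G tp0 :=
  mkq (monus (qpos q) (qneg q) + monus (qneg q) (qpos q)) 0 (snd0 q).

(* the rationals 2^-n and 2^(-n+1) *)
Definition qexp G (n : tm G tp0) : tm G tp0 := mkq 1 0 (pred0 (exp2 n)).
Definition qexp' G (n : tm G tp0) : tm G tp0 := qadd (qexp n) (qexp n).

Definition isReal G (x : tm G tp1) : fm G :=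
  All tp0 (All tp0
    (qlt (qabs (qsub (wk (wk x) `@ v1) (wk (wk x) `@ (v1 + v0)))) (qexp v1))).

Definition req G (x y : tm G tp1) : fm G :=
  All tp0 (qle (qabs (qsub (wk x `@ v0) (wk y `@ v0))) (qexp' v0)).
Definition rle G (x y : tm G tp1) : fm G :=
  All tp0 (qle (wk x `@ v0) (qadd (wk y `@ v0) (qexp' v0))).
Definition rlt G (x y : tm G tp1) : fm G :=
  Ex tp0 (qlt (qadd (wk x `@ v0) (qexp' v0)) (wk y `@ v0)).

(* The index shift restores the rate of convergence 2^-n. *)
Definition radd G (x y : tm G tp1) : tm G tp1 :=
  lam (qadd (wk x `@ (v0 + 1)) (wk y `@ (v0 + 1))).
Definition rsub G (x y : tm G tp1) : tm G tp1 :=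
  lam (qsub (wk x `@ (v0 + 1)) (wk y `@ (v0 + 1))).
Definition rabs G (x : tm G tp1) : tm G tp1 := lam (qabs (wk x `@ v0)).

Definition r0 G : tm G tp1 := lam (mkq 0 0 0).
Definition r1 G : tm G tp1 := lam (mkq 1 0 0).
Arguments r0 {G}.
Arguments r1 {G}.

Definition in01 G (x : tm G tp1) : fm G :=
  isReal x `/\ rle r0 x `/\ rle x r1.

Definition allR G (A : fm (tp1 :: G)) : fm G := All tp1 (isReal v0 `-> A).
Definition exR G (A : fm (tp1 :: G)) : fm G := Ex tp1 (isReal v0 `/\ A).

Definition RtoR G (f : tm G (tp1 ~> tp1)) : fm G :=
  allR (isReal (wk f `@ v0)) `/\
  allR (allR (req v1 v0 `-> req (wk (wk f) `@ v1) (wk (wk f) `@ v0))).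

Definition RtoRpos G (f : tm G (tp1 ~> tp1)) : fm G :=
  RtoR f `/\ allR (rlt r0 (wk f `@ v0)).

Definition char_set G (F : tm G tp2) : fm G := All tp1 (wk F `@ v0 `<= 1).
Definition char_rel G (P : tm G (tp1 ~> tp1 ~> tp0)) : fm G :=
  All tp1 (All tp1 (wk (wk P) `@ v1 `@ v0 `<= 1)).

Definition inD G (F : tm G tp2) (d : tm G tp1) : fm G := F `@ d `= 1.
Definition prec G (P : tm G (tp1 ~> tp1 ~> tp0)) (d e : tm G tp1) : fm G :=
  P `@ d `@ e `= 1.

Definition allD G (F : tm G tp2) (A : fm (tp1 :: G)) : fm G :=
  All tp1 (inD (wk F) v0 `-> A).
Definition exD G (F : tm G tp2) (A : fm (tp1 :: G)) : fm G :=
  Ex tp1 (inD (wk F) v0 `/\ A).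

Definition directed G (F : tm G tp2) (P : tm G (tp1 ~> tp1 ~> tp0)) : fm G :=
  Ex tp1 (inD (wk F) v0) `/\
  allD F (prec (wk P) v0 v0) `/\
  allD F (allD (wk F) (allD (wk (wk F))
    (prec (wk (wk (wk P))) v2 v1 `-> prec (wk (wk (wk P))) v1 v0 `->
     prec (wk (wk (wk P))) v2 v0))) `/\
  allD F (allD (wk F) (exD (wk (wk F))
    (prec (wk (wk (wk P))) v2 v0 `/\ prec (wk (wk (wk P))) v1 v0))).

(* The net is the restriction of [x : 1 -> 1] to the set given by [F]. *)
Definition net_in01 G (F : tm G tp2) (P : tm G (tp1 ~> tp1 ~> tp0))
    (x : tm G (tp1 ~> tp1)) : fm G :=
  char_set F `/\ char_rel P `/\ directed F P `/\ allD F (in01 (wk x `@ v0)).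

Definition increasing G (F : tm G tp2) (P : tm G (tp1 ~> tp1 ~> tp0))
    (x : tm G (tp1 ~> tp1)) : fm G :=
  allD F (allD (wk F)
    (prec (wk (wk P)) v1 v0 `-> rle (wk (wk x) `@ v1) (wk (wk x) `@ v0))).

Definition converges_to G (F : tm G tp2) (P : tm G (tp1 ~> tp1 ~> tp0))
    (x : tm G (tp1 ~> tp1)) (y : tm G tp1) : fm G :=
  (* v2 = epsilon, v1 = d_0, v0 = e *)
  allR (rlt r0 v0 `->
    exD (wk F) (allD (wk (wk F))
      (prec (wk (wk (wk P))) v1 v0 `->
       rlt (rabs (rsub (wk (wk (wk x)) `@ v0) (wk (wk (wk y))))) v2))).

Definition MCT0_net : fm [::] :=
  (* v2 = F, v1 = P, v0 = x *)
  All tp2 (All (tp1 ~> tp1 ~> tp0) (All (tp1 ~> tp1)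
    (net_in01 v2 v1 v0 `-> increasing v2 v1 v0 `->
     exR (converges_to v3 v2 v1 v0)))).

Definition in_ball G (x y r : tm G tp1) : fm G :=
  rlt (rsub y r) x `/\ rlt x (radd y r).

(* The finite sequence y_1, ..., y_k is given by its length [k] and a functional
   [y] of type 0 -> 1, of which the values at i < k are used. *)
Definition HBU : fm [::] :=
  All (tp1 ~> tp1) (* Psi *) (RtoRpos v0 `->
    Ex tp0 (* k *) (Ex (tp0 ~> tp1) (* y *)
      (All tp0 (* i *) (v0 `< v2 `-> in01 (v1 `@ v0)) `/\
       All tp1 (* x *) (in01 v0 `->
         Ex tp0 (* i *)
           (v0 `< v3 `/\ in_ball v1 (v2 `@ v0) (v4 `@ (v2 `@ v0))))))).

(* Main.v *)
From Stdlib Require Import FunctionalExtensionality PropExtensionality.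
From Stdlib Require Import ClassicalEpsilon Classical ProofIrrelevance.
From Stdlib Require List.
From HB Require Import structures.
From mathcomp Require Import all_boot all_order all_algebra ring lra.
From mathcomp Require boolp.
Require Import Defs.

(** By a Henkin construction it suffices to show that every model of the base
    theory in which monotone nets converge satisfies HBU.  In a model, any type 2
    functional [g] with rational values in [0,1] is itself an increasing net when
    Baire space is (decidably) directed by [g d <= g e], so [g] has a supremum.
    Given [Psi], code a finite chain of balls [(y_i - Psi y_i, y_i + Psi y_i)] by
    an element of Baire space, together with rational endpoints
    [0 = l_0, l_1, ..., l_k] in [0,1] such that the [i]-th ball contains
    [[l_i, l_(i+1)]], verified at a finite precision; validity of a code is then
    decidable.  Let [g] map a valid code to [l_k] and any other sequence to 0, and
    let [y] be the supremum of [g].  A chain whose last endpoint is close enough to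
    [y] can be continued by the ball around [y], whose right part would exceed the
    supremum unless the new endpoint is 1; the chain obtained covers [0,1]. *)

Set Implicit Arguments.
Unset Strict Implicit.
Unset Printing Implicit Defensive.
Import Order.TTheory GRing.Theory Num.Theory.

(** * Substitution in derivations *)

(** The numbers of a model may be nonstandard, so an induction along a chain cannot be carried out
    in the metatheory: it has to be an instance of quantifier-free induction, and the statement is
    first brought into that form by terms that decide or compute what it mentions. The index order
    of a net needs a characteristic function, and the order of reals need not have one in a model;
    this is why [g] takes rational values and why each ball of a code stores its own precision.
    Being a real is not a decidable condition on a sequence either, so the centres of a code are
    repaired instead of checked: [normal] turns any sequence into a real in [0,1] and preserves the
    reals of [0,1] up to equality. Codes of rationals are not unique and numbers have no
    subtraction; inequalities are therefore proved in the ordered field of fractions [fracM], where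
    [lra] and [field] apply. *)

Definition var_consP (t : ty) (G : ctx) (P : forall s, var (t :: G) s -> Prop)
    (PZ : P t (VZ G t)) (PS : forall s (v : var G s), P s (VS t v)) :
  forall s (v : var (t :: G) s), P s v :=
  fun s v =>
  match v in var H u return
    match H return var H u -> Prop with
    | [::] => fun _ => True
    | t' :: G' => fun v => forall P : (forall s, var (t' :: G') s -> Prop),
        P t' (VZ G' t') -> (forall s (v : var G' s), P s (VS t' v)) -> P u v
    end v
  with
  | VZ _ _ => fun P PZ PS => PZ
  | VS _ _ _ w => fun P PZ PS => PS _ w
  end P PZ PS.

Lemma var_nilP (s : ty) (v : var [::] s) (P : Prop) : P.
Proof. by case: (vnil (fun _ => void) v). Qed.

Lemma vfun_ext (P : ty -> Type) G (f g : forall s, var G s -> P s) :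
  (forall s v, f s v = g s v) -> f = g.
Proof.
move=> fg; apply: functional_extensionality_dep => s.
exact: functional_extensionality_dep.
Qed.

Lemma sub_tm_ren G G' G'' (f : sub G' G'') (r : ren G G') s (u : tm G s) :
  sub_tm f (ren_tm r u) = sub_tm (fun s v => f s (r s v)) u.
Proof. by elim: u => //= s1 t g -> a ->. Qed.

Lemma ren_tm_sub G G' G'' (f : sub G G') (r : ren G' G'') s (u : tm G s) :
  ren_tm r (sub_tm f u) = sub_tm (fun s v => ren_tm r (f s v)) u.
Proof. by elim: u => //= s1 t g -> a ->. Qed.

Lemma sub_tm_comp G G' G'' (f : sub G' G'') (g : sub G G') s (u : tm G s) :
  sub_tm f (sub_tm g u) = sub_tm (fun s v => sub_tm f (g s v)) u.
Proof. by elim: u => //= s1 t h -> a ->. Qed.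

Lemma ren_tmE G G' (r : ren G G') s (u : tm G s) :
  ren_tm r u = sub_tm (fun s v => Var (r s v)) u.
Proof. by elim: u => //= s1 t h -> a ->. Qed.

Lemma sub_tm_var G s (u : tm G s) : sub_tm (fun s v => Var v) u = u.
Proof. by elim: u => //= s1 t h -> a ->. Qed.

Lemma wkE G t s (u : tm G s) : wk u = sub_tm (fun s v => Var (VS t v)) u.
Proof. exact: ren_tmE. Qed.

Lemma sub_tm_wk G G' t (f : sub (t :: G) G') s (u : tm G s) :
  sub_tm f (wk u) = sub_tm (fun s v => f s (VS t v)) u.
Proof. exact: sub_tm_ren. Qed.

Lemma wk_sub_tm G G' t (f : sub G G') s (u : tm G s) :
  wk (sub_tm f u) = sub_tm (fun s v => wk (f s v)) u :> tm (t :: G') s.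
Proof. exact: ren_tm_sub. Qed.

Lemma scons_eta G G' t (f : sub (t :: G) G') :
  scons (f t (VZ G t)) (fun s v => f s (VS t v)) = f.
Proof. by apply: vfun_ext; apply: var_consP. Qed.

Lemma up_sub_comp G G' G'' (f : sub G' G'') (g : sub G G') t :
  (fun s v => sub_tm (up_sub f (t := t)) ((up_sub g (t := t)) s v)) =
  up_sub (fun s v => sub_tm f (g s v)) (t := t).
Proof.
apply: vfun_ext; apply: var_consP => //= s v.
by rewrite /up_sub /= sub_tm_wk wk_sub_tm.
Qed.

Lemma up_sub_var G G' (r : ren G G') t :
  up_sub (fun s v => Var (r s v)) (t := t) = fun s v => Var ((up_ren r (t := t)) s v).
Proof. by apply: vfun_ext; apply: var_consP. Qed.

Lemma sub_fm_comp G (A : fm G) : forall G' G'' (f : sub G' G'') (g : sub G G'),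
  sub_fm f (sub_fm g A) = sub_fm (fun s v => sub_tm f (g s v)) A.
Proof.
elim: A => {G} [G a b|G a b|G|G A IA B IB|G A IA B IB|G A IA B IB|G s A IA|G s A IA]
  G' G'' f g //=; rewrite ?sub_tm_comp ?IA ?IB ?up_sub_comp //.
Qed.

Lemma ren_fmE G (A : fm G) : forall G' (r : ren G G'),
  ren_fm r A = sub_fm (fun s v => Var (r s v)) A.
Proof.
elim: A => {G} [G a b|G a b|G|G A IA B IB|G A IA B IB|G A IA B IB|G s A IA|G s A IA]
  G' r //=; rewrite ?ren_tmE ?IA ?IB ?up_sub_var //.
Qed.

Lemma sub_fm_var G (A : fm G) : sub_fm (fun s v => Var v) A = A.
Proof.
have up H t : up_sub (fun s (v : var H s) => Var v) (t := t) = (fun s v => @Var (t :: H) s v).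
  by apply: vfun_ext; apply: var_consP.
elim: A => {G} [G a b|G a b|G|G A IA B IB|G A IA B IB|G A IA B IB|G s A IA|G s A IA] //=;
  by rewrite ?sub_tm_var ?up ?IA ?IB.
Qed.

Lemma wk_fmE G t (A : fm G) : wk_fm A = sub_fm (fun s v => Var (VS t v)) A.
Proof. exact: ren_fmE. Qed.

Lemma sub_fm_wk G G' t (f : sub (t :: G) G') (A : fm G) :
  sub_fm f (wk_fm A) = sub_fm (fun s v => f s (VS t v)) A.
Proof. by rewrite wk_fmE sub_fm_comp. Qed.

Lemma wk_sub_fm G G' t (f : sub G G') (A : fm G) :
  wk_fm (sub_fm f A) = sub_fm (fun s v => wk (f s v)) A :> fm (t :: G').
Proof.
rewrite wk_fmE sub_fm_comp; congr sub_fm; apply: vfun_ext => s v.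
by rewrite wkE.
Qed.

Lemma sub_fm_up_wk G G' t (f : sub G G') (A : fm G) :
  sub_fm (up_sub f (t := t)) (wk_fm A) = wk_fm (sub_fm f A).
Proof. by rewrite sub_fm_wk wk_sub_fm. Qed.

Lemma inst_sub G G' t (f : sub G G') (A : fm (t :: G)) u :
  inst (sub_fm (up_sub f (t := t)) A) u = sub_fm (scons u f) A.
Proof.
rewrite /inst sub_fm_comp; congr sub_fm; apply: vfun_ext; apply: var_consP => //= s v.
by rewrite /up_sub /= sub_tm_wk /= sub_tm_var.
Qed.

Lemma sub_inst G G' t (f : sub G G') (A : fm (t :: G)) u :
  sub_fm f (inst A u) = sub_fm (scons (sub_tm f u) f) A.
Proof.
rewrite /inst sub_fm_comp; congr sub_fm; by apply: vfun_ext; apply: var_consP.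
Qed.

Lemma sub_wk_sentence G G' (f : sub G G') A :
  sub_fm f (wk_sentence A) = wk_sentence A.
Proof.
rewrite /wk_sentence !ren_fmE sub_fm_comp; congr sub_fm; apply: vfun_ext => s v.
exact: var_nilP v _.
Qed.

Section Derivations.
Variable T : theory.

Lemma deriv_weaken G (H H' : seq (fm G)) A :
  deriv T H A -> (forall B, List.In B H -> List.In B H') -> deriv T H' A.
Proof.
move=> d; elim: d H' => {G H A}.
- by move=> *; apply: d_axiom.
- by move=> G H A HA H' sH; apply: d_hyp; apply: sH.
- move=> G H A B _ IH H' sH; apply: d_impI; apply: IH => C [->|/sH]; by [left|right].
- by move=> G H A B _ IH1 _ IH2 H' sH; apply: d_impE (IH1 _ sH) (IH2 _ sH).
- by move=> G H A B _ IH1 _ IH2 H' sH; apply: d_andI (IH1 _ sH) (IH2 _ sH).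
- by move=> G H A B _ IH H' sH; apply: d_andE1 (IH _ sH).
- by move=> G H A B _ IH H' sH; apply: d_andE2 (IH _ sH).
- by move=> G H A B _ IH H' sH; apply: d_orI1 (IH _ sH).
- by move=> G H A B _ IH H' sH; apply: d_orI2 (IH _ sH).
- move=> G H A B C _ IH1 _ IH2 _ IH3 H' sH; apply: d_orE (IH1 _ sH) _ _.
    by apply: IH2 => D [->|/sH]; [left|right].
  by apply: IH3 => D [->|/sH]; [left|right].
- by move=> G H A _ IH H' sH; apply: d_raa; apply: IH => D [->|/sH]; [left|right].
- move=> G H s A _ IH H' sH; apply: d_allI; apply: IH => B.
  rewrite !List.in_map_iff => -[C [<- /sH HC]]; by exists C.
- by move=> G H s A u _ IH H' sH; apply: d_allE (IH _ sH).
- by move=> G H s A u _ IH H' sH; apply: d_exI (IH _ sH).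
- move=> G H s A C _ IH1 _ IH2 H' sH; apply: d_exE (IH1 _ sH) _.
  apply: IH2 => B /= [->|]; first by left.
  rewrite !List.in_map_iff => -[D [<- /sH HD]]; by right; exists D.
Qed.

(** The induction covers all substitutions at once because the quantifier rules enlarge the context,
    where [f] is replaced by [up_sub f]. *)
Lemma deriv_sub G (H : seq (fm G)) A : deriv T H A ->
  forall G' (f : sub G G'), deriv T (map (sub_fm f) H) (sub_fm f A).
Proof.
have wkmap G0 G1 (f : sub G0 G1) t (H0 : seq (fm G0)) :
    map (sub_fm (up_sub f (t := t))) (map wk_fm H0) = map wk_fm (map (sub_fm f) H0).
  by rewrite -!map_comp; apply: eq_map => B /=; rewrite sub_fm_up_wk.
move=> d; elim: d => {G H A}.
- by move=> G H A TA G' f; rewrite sub_wk_sentence; apply: d_axiom.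
- by move=> G H A HA G' f; apply: d_hyp; apply: List.in_map.
- by move=> G H A B _ IH G' f; apply: d_impI; apply: IH.
- by move=> G H A B _ IH1 _ IH2 G' f; apply: d_impE (IH1 _ f) (IH2 _ f).
- by move=> G H A B _ IH1 _ IH2 G' f; apply: d_andI (IH1 _ f) (IH2 _ f).
- by move=> G H A B _ IH G' f; apply: d_andE1 (IH _ f).
- by move=> G H A B _ IH G' f; apply: d_andE2 (IH _ f).
- by move=> G H A B _ IH G' f; apply: d_orI1 (IH _ f).
- by move=> G H A B _ IH G' f; apply: d_orI2 (IH _ f).
- by move=> G H A B C _ IH1 _ IH2 _ IH3 G' f;
    apply: d_orE (IH1 _ f) (IH2 _ f) (IH3 _ f).
- by move=> G H A _ IH G' f; apply: d_raa; apply: IH.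
- by move=> G H s A _ IH G' f; apply: d_allI; rewrite -wkmap; apply: IH.
- move=> G H s A u _ IH G' f; rewrite sub_inst -inst_sub; apply: d_allE; exact: IH.
- move=> G H s A u _ IH G' f; apply: (d_exI (u := sub_tm f u)).
  by rewrite inst_sub -sub_inst; apply: IH.
- move=> G H s A C _ IH1 _ IH2 G' f; apply: d_exE (IH1 _ f) _.
  by rewrite -wkmap -sub_fm_up_wk; apply: IH2.
Qed.

Lemma deriv_wk G t (H : seq (fm G)) A :
  deriv T H A -> deriv T (map (@wk_fm G t) H) (wk_fm A).
Proof.
move=> /deriv_sub /(_ (t :: G) (fun s v => Var (VS t v))).
by rewrite wk_fmE; congr deriv; apply: eq_map => B; rewrite wk_fmE.
Qed.

Lemma deriv_botE G (H : seq (fm G)) A : deriv T H Bot -> deriv T H A.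
Proof. by move=> d; apply: d_raa; apply: deriv_weaken d _; right. Qed.

Lemma deriv_cons G (H : seq (fm G)) A B : deriv T H A -> deriv T (B :: H) A.
Proof. by move=> d; apply: deriv_weaken d _; right. Qed.

Lemma deriv_head G (H : seq (fm G)) A : deriv T (A :: H) A.
Proof. by apply: d_hyp; left. Qed.

End Derivations.

(** * Enumeration of formulas *)

Fixpoint ty_code (t : ty) : GenTree.tree unit :=
  match t with
  | tp0 => GenTree.Node 0 [::]
  | Arr s t => GenTree.Node 1 [:: ty_code s; ty_code t]
  end.

Fixpoint ty_decode (c : GenTree.tree unit) : option ty :=
  match c with
  | GenTree.Node 0 [::] => Some tp0
  | GenTree.Node 1 [:: c; d] =>
      if (ty_decode c, ty_decode d) is (Some s, Some t) then Some (Arr s t) else None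
  | _ => None
  end.

Lemma ty_codeK : pcancel ty_code ty_decode.
Proof. by elim=> //= s -> t ->. Qed.

HB.instance Definition _ := Countable.copy ty (pcan_type ty_codeK).

Fixpoint var_code G s (v : var G s) : nat :=
  match v with VZ _ _ => 0 | VS _ _ _ w => (var_code w).+1 end.

Fixpoint var_decode G (n : nat) : option {s & var G s} :=
  match G, n with
  | t :: G', 0 => Some (existT _ t (VZ G' t))
  | t :: G', n'.+1 =>
      if var_decode G' n' is Some (existT s v) then Some (existT _ s (VS t v)) else None
  | [::], _ => None
  end.

Lemma var_codeK G s (v : var G s) : var_decode G (var_code v) = Some (existT _ s v).
Proof. by elim: v => //= {}G {}s t v ->. Qed.

Fixpoint tm_code G s (u : tm G s) : GenTree.tree ty :=
  match u with
  | Var s v => GenTree.Node (8 + var_code v) [::]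
  | App s t f a => GenTree.Node 0 [:: tm_code f; tm_code a]
  | Zero => GenTree.Node 1 [::]
  | One => GenTree.Node 2 [::]
  | Plus => GenTree.Node 3 [::]
  | Times => GenTree.Node 4 [::]
  | Pi s t => GenTree.Node 5 [:: GenTree.Leaf s; GenTree.Leaf t]
  | Sigma r s t => GenTree.Node 6 [:: GenTree.Leaf r; GenTree.Leaf s; GenTree.Leaf t]
  | Rec => GenTree.Node 7 [::]
  end.

Definition app_decode G (f a : {s & tm G s}) : option {s & tm G s} :=
  match f with
  | existT (Arr s t) f' =>
      if @eqP _ (tag a) s is ReflectT e
      then Some (existT _ t (App f' (eq_rect _ (tm G) (tagged a) _ e))) else None
  | _ => None
  end.

Fixpoint tm_decode G (c : GenTree.tree ty) : option {s & tm G s} :=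
  match c with
  | GenTree.Node 0 [:: c; d] =>
      if (tm_decode G c, tm_decode G d) is (Some f, Some a) then app_decode f a else None
  | GenTree.Node 1 _ => Some (existT _ _ Zero)
  | GenTree.Node 2 _ => Some (existT _ _ One)
  | GenTree.Node 3 _ => Some (existT _ _ Plus)
  | GenTree.Node 4 _ => Some (existT _ _ Times)
  | GenTree.Node 5 [:: GenTree.Leaf s; GenTree.Leaf t] => Some (existT _ _ (Pi s t))
  | GenTree.Node 6 [:: GenTree.Leaf r; GenTree.Leaf s; GenTree.Leaf t] =>
      Some (existT _ _ (Sigma r s t))
  | GenTree.Node 7 _ => Some (existT _ _ Rec)
  | GenTree.Node (n.+4.+4) _ =>
      if var_decode G n is Some (existT s v) then Some (existT _ s (Var v)) else None
  | _ => None
  end.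

Lemma tm_codeK G s (u : tm G s) : tm_decode G (tm_code u) = Some (existT _ s u).
Proof.
elim: u => //= [{}s v | {}s t f -> a ->] /=; first by rewrite var_codeK.
by case: eqP => //= e; rewrite eq_axiomK.
Qed.

Fixpoint fm_code G (A : fm G) : GenTree.tree (ty + GenTree.tree ty) :=
  match A with
  | Eq0 a b =>
      GenTree.Node 0 [:: GenTree.Leaf (inr (tm_code a)); GenTree.Leaf (inr (tm_code b))]
  | Lt0 a b =>
      GenTree.Node 1 [:: GenTree.Leaf (inr (tm_code a)); GenTree.Leaf (inr (tm_code b))]
  | Bot => GenTree.Node 2 [::]
  | And A B => GenTree.Node 3 [:: fm_code A; fm_code B]
  | Or A B => GenTree.Node 4 [:: fm_code A; fm_code B]
  | Imp A B => GenTree.Node 5 [:: fm_code A; fm_code B]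
  | All s A => GenTree.Node 6 [:: GenTree.Leaf (inl s); fm_code A]
  | Ex s A => GenTree.Node 7 [:: GenTree.Leaf (inl s); fm_code A]
  end.

Definition tm0_decode G (c : GenTree.tree ty) : option (tm G tp0) :=
  if tm_decode G c is Some (existT tp0 u) then Some u else None.

Lemma tm0_codeK G (u : tm G tp0) : tm0_decode G (tm_code u) = Some u.
Proof. by rewrite /tm0_decode tm_codeK. Qed.

Fixpoint fm_decode G (c : GenTree.tree (ty + GenTree.tree ty)) : option (fm G) :=
  match c with
  | GenTree.Node 0 [:: GenTree.Leaf (inr a); GenTree.Leaf (inr b)] =>
      if (tm0_decode G a, tm0_decode G b) is (Some a, Some b) then Some (Eq0 a b) else None
  | GenTree.Node 1 [:: GenTree.Leaf (inr a); GenTree.Leaf (inr b)] =>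
      if (tm0_decode G a, tm0_decode G b) is (Some a, Some b) then Some (Lt0 a b) else None
  | GenTree.Node 3 [:: c; d] =>
      if (fm_decode G c, fm_decode G d) is (Some A, Some B) then Some (And A B) else None
  | GenTree.Node 4 [:: c; d] =>
      if (fm_decode G c, fm_decode G d) is (Some A, Some B) then Some (Or A B) else None
  | GenTree.Node 5 [:: c; d] =>
      if (fm_decode G c, fm_decode G d) is (Some A, Some B) then Some (Imp A B) else None
  | GenTree.Node 6 [:: GenTree.Leaf (inl s); c] => omap (All s) (fm_decode (s :: G) c)
  | GenTree.Node 7 [:: GenTree.Leaf (inl s); c] => omap (Ex s) (fm_decode (s :: G) c)
  | _ => Some Bot
  end.

Lemma fm_codeK G : pcancel (@fm_code G) (@fm_decode G).
Proof.
elim=> {G} //= [G a b|G a b|G A -> B ->|G A -> B ->|G A -> B ->|G s A ->|G s A ->] //;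
  by rewrite !tm0_codeK.
Qed.

Definition fm_enum G (n : nat) : fm G :=
  odflt Bot (obind (@fm_decode G) (unpickle n)).

Lemma fm_enum_surj G (A : fm G) : exists n, fm_enum G n = A.
Proof. by exists (pickle (fm_code A)); rewrite /fm_enum pickleK /= fm_codeK. Qed.

(** * Henkin construction *)

(** Constant functions inhabit every type. These terms fill the stages before the one at which an
    element is introduced. *)
Fixpoint closed_tm G (s : ty) : tm G s :=
  match s with
  | tp0 => Zero
  | Arr r t => App (Pi t r) (closed_tm G t)
  end.

Section Henkin.
Variable T : theory.

Definition consistent G (H : seq (fm G)) := ~ deriv T H Bot.

(* The new variable added to the context witnesses [A] if [A] is existential. *)
Definition extend G (H : seq (fm G)) (A : fm G) : {t & seq (fm (t :: G))} :=
  if excluded_middle_informative (consistent (A :: H)) then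
    match A with
    | Ex s B => existT _ s (B :: map wk_fm (A :: H))
    | _ => existT _ tp0 (map wk_fm (A :: H))
    end
  else existT _ tp0 (map wk_fm H).

Lemma extend_sub G (H : seq (fm G)) A B :
  List.In B H -> List.In (wk_fm B) (projT2 (extend H A)).
Proof.
move=> HB; rewrite /extend; case: excluded_middle_informative => _ /=.
  by case: A => *; rewrite /=; do ?right; apply: List.in_map.
exact: List.in_map.
Qed.

Lemma extend_in G (H : seq (fm G)) A :
  consistent (A :: H) -> List.In (wk_fm A) (projT2 (extend H A)).
Proof.
move=> cA; rewrite /extend; case: excluded_middle_informative => // _ /=.
by case: (A) => *; rewrite /=; try (by left); by right; left.
Qed.

Lemma extend_witness G (H : seq (fm G)) A s (B : fm (s :: G)) :
  A = Ex s B -> consistent (A :: H) ->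
  exists x : tm (projT1 (extend H A) :: G) s,
    deriv T (projT2 (extend H A)) (sub_fm (scons x (fun s v => Var (VS _ v))) B).
Proof.
move=> -> cA; rewrite /extend; case: excluded_middle_informative => // _ /=.
exists (Var (VZ _ _)).
rewrite (scons_eta (fun s v => @Var _ s v)) sub_fm_var; exact: deriv_head.
Qed.

(** The fresh variable has type 0, so a contradiction in the larger context can be instantiated by
    [Zero]. *)
Lemma consistent_wk G (H : seq (fm G)) : consistent H -> consistent (map (@wk_fm G tp0) H).
Proof.
move=> cH d; apply: cH.
exact: (d_allE (A := Bot) Zero (d_allI d)).
Qed.

Lemma consistent_extend G (H : seq (fm G)) A :
  consistent H -> consistent (projT2 (extend H A)).
Proof.
move=> cH; rewrite /extend.
case: excluded_middle_informative => cA /=; last exact: consistent_wk.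
case: A cA => [a b|a b||A B|A B|A B|s B|s B] cA; try exact: (consistent_wk (H := _ :: _)).
move=> d; apply: cA; exact: (d_exE (A := B) (C := Bot) (deriv_head _ _ _) d).
Qed.

Record stage := Stage {
  stage_ctx : ctx;
  stage_hyps : seq (fm stage_ctx);
  (* [stage_task m i] is the [i]-th formula in the context of stage [m],
     weakened to the present context *)
  stage_task : nat -> nat -> fm stage_ctx }.

(** The discarded third component of the decoded triple makes every pair recur infinitely often. *)
Definition schedule (n : nat) : nat * nat :=
  if (unpickle n : option (nat * nat * nat)) is Some (p, _) then p else (0, 0).

Lemma schedule_often m i N : exists n, N <= n /\ schedule n = (m, i).
Proof.
pose f (k : 'I_N.+1) : nat := pickle ((m, i), k : nat).
have fE k : schedule (f k) = (m, i) by rewrite /schedule /f pickleK.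
have finj : injective f.
  by move=> k l /(pcan_inj pickleK) [] /val_inj.
apply: NNPP => no.
have ltf k : f k < N.
  by rewrite ltnNge; apply/negP => le; apply: no; exists (f k).
(* Pigeonhole: the distinct codes of [(m, i, k)] for [k <= N] cannot all be below [N]. *)
have := @leq_card _ _ (fun k => Ordinal (ltf k)) _.
rewrite !card_ord ltnn => /(_ _)/notF; apply.
by move=> k l [] /finj.
Qed.

Definition next_task (S : stage) n := stage_task S (schedule n).1 (schedule n).2.
Definition next (S : stage) n := extend (stage_hyps S) (next_task S n).

Definition stage_succ n (S : stage) : stage :=
  @Stage (projT1 (next S n) :: stage_ctx S) (projT2 (next S n))
    (fun m i => if m == n.+1 then fm_enum _ i else wk_fm (stage_task S m i)).

Variable (A0 : fm [::]).
Hypothesis cA0 : consistent [:: A0].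

Fixpoint stages n : stage :=
  match n with
  | 0 => @Stage [::] [:: A0] (fun m i => fm_enum _ i)
  | n.+1 => stage_succ n (stages n)
  end.

Notation Gn n := (stage_ctx (stages n)).
Notation Hn n := (stage_hyps (stages n)).

Lemma consistent_stage n : consistent (Hn n).
Proof. by elim: n => //= n IH; apply: consistent_extend. Qed.

Definition up n s (u : tm (Gn n) s) : tm (Gn n.+1) s := wk u.
Definition up_fm n (A : fm (Gn n)) : fm (Gn n.+1) := wk_fm A.

Lemma deriv_up n A : deriv T (Hn n) A -> deriv T (Hn n.+1) (up_fm A).
Proof.
move=> /(deriv_wk (projT1 (next (stages n) n))) d.
apply: deriv_weaken d _ => B; rewrite List.in_map_iff => -[C [<- HC]].
exact: extend_sub.
Qed.

Definition coherent s (u : forall n, tm (Gn n) s) N :=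
  forall n, N <= n -> u n.+1 = up (u n).

(** Elements of the direct limit of the terms over the growing contexts. What the family does before
    it becomes coherent is irrelevant. *)
Definition elt s := {u : forall n, tm (Gn n) s | exists N, coherent u N}.
Definition at_ s (d : elt s) n : tm (Gn n) s := proj1_sig d n.

Lemma elt_from n0 s (x : tm (Gn n0) s) :
  exists d : elt s, at_ d n0 = x /\ coherent (at_ d) n0.
Proof.
(* [cast] returns [y] transported to stage [n] if [m = n], and [z] otherwise. *)
pose cast n m (y : tm (Gn m) s) (z : tm (Gn n) s) : tm (Gn n) s :=
  if @eqP _ m n is ReflectT e then eq_rect m (fun k => tm (Gn k) s) y n e else z.
pose fix u n : tm (Gn n) s :=
  match n with
  | 0 => cast 0 n0 x (closed_tm _ _)
  | n.+1 => cast n.+1 n0 x (up (u n))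
  end.
have u0 : u n0 = x.
  have cx z : cast n0 n0 x z = x by rewrite /cast; case: eqP => // e; rewrite eq_axiomK.
  by case: (n0) x @u cx => [|m] x u cx; apply: cx.
have uS : coherent u n0.
  move=> n le /=; rewrite /cast; case: eqP => // e; exfalso; by move: le; rewrite e ltnn.
by exists (exist _ u (ex_intro _ n0 uS)).
Qed.

Definition env G := forall s, var G s -> elt s.
Definition econs G s (d : elt s) (e : env G) : env (s :: G) := vcase d e.
Definition eat G (e : env G) n : sub G (Gn n) := fun s v => at_ (e s v) n.

Lemma eat_econs G s (d : elt s) (e : env G) n :
  eat (econs d e) n = scons (at_ d n) (eat e n).
Proof. by apply: vfun_ext; apply: var_consP. Qed.

Definition ecoherent G (e : env G) N :=
  forall n, N <= n -> eat e n.+1 = fun s v => up (eat e n v).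

Lemma ecoherentP G (e : env G) : exists N, ecoherent e N.
Proof.
elim: G e => [|t G IH] e.
  by exists 0 => n _; apply: vfun_ext => s v; apply: var_nilP v _.
have [N1 c1] := IH (fun s v => e s (VS t v)).
have [N2 c2] := proj2_sig (e t (VZ G t)).
exists (maxn N1 N2) => n; rewrite geq_max => /andP[le1 le2].
apply: vfun_ext; apply: var_consP; first exact: c2.
by move=> s v; move: (c1 n le1) => /(congr1 (fun f : sub _ _ => f s v)).
Qed.

Lemma sub_eatS G (e : env G) N n (A : fm G) : ecoherent e N -> N <= n ->
  sub_fm (eat e n.+1) A = up_fm (sub_fm (eat e n) A).
Proof. by move=> c le; rewrite /up_fm wk_sub_fm c. Qed.

Lemma sub_tm_eatS G (e : env G) N n s (u : tm G s) : ecoherent e N -> N <= n ->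
  sub_tm (eat e n.+1) u = up (sub_tm (eat e n) u).
Proof. by move=> c le; rewrite /up wk_sub_tm c. Qed.

(** Truth in the limit theory. Derivability persists from stage to stage, so by [tr_at] a single
    late stage is enough. *)
Definition tr G (A : fm G) (e : env G) :=
  exists N, forall n, N <= n -> deriv T (Hn n) (sub_fm (eat e n) A).

Lemma tr_at G (A : fm G) (e : env G) N n : ecoherent e N -> N <= n ->
  deriv T (Hn n) (sub_fm (eat e n) A) -> tr A e.
Proof.
move=> c le d; exists n; elim=> [|m IH].
  by rewrite leqn0 => /eqP e0; move: d; rewrite e0.
rewrite leq_eqVlt => /orP[/eqP<- //|lt].
by rewrite (sub_eatS _ c) ?(leq_trans le lt) //; apply: deriv_up; apply: IH.
Qed.

Lemma tr_map G1 G2 (A : fm G1) (B : fm G2) e1 e2 :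
  (exists N, forall n, N <= n -> deriv T (Hn n) (sub_fm (eat e1 n) A) ->
     deriv T (Hn n) (sub_fm (eat e2 n) B)) -> tr A e1 -> tr B e2.
Proof.
move=> [N1 AB] [N2 dA]; exists (maxn N1 N2) => n.
by rewrite geq_max => /andP[le1 le2]; apply: AB => //; apply: dA.
Qed.

Lemma stage_taskE G (A : fm G) (e : env G) N : ecoherent e N ->
  exists i, forall n, N <= n -> stage_task (stages n) N i = sub_fm (eat e n) A.
Proof.
move=> c; have [i Ei] := fm_enum_surj (sub_fm (eat e N) A); exists i.
elim=> [|n IH].
  by rewrite leqn0 => /eqP N0; move: Ei; rewrite N0.
rewrite leq_eqVlt => /orP[/eqP EN|lt].
  by rewrite EN in Ei *; rewrite /= eqxx.
by rewrite /= (ltn_eqF lt) (IH lt) (sub_eatS _ c).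
Qed.

Lemma handled G (A : fm G) (e : env G) N1 : exists N n, 
  [/\ ecoherent e N, N <= n, N1 <= n &
      next_task (stages n) n = sub_fm (eat e n) A].
Proof.
have [N c] := ecoherentP e; have [i Hi] := stage_taskE A c.
have [n [le sn]] := schedule_often N i (maxn N N1).
move: le; rewrite geq_max => /andP[le1 le2].
by exists N, n; split=> //; rewrite /next_task sn Hi.
Qed.

(** At the stage that treats [A], either [A] is added or it is refutable from the hypotheses
    collected so far. *)
Lemma tr_decide G (A : fm G) e : tr A e \/ tr (Imp A Bot) e.
Proof.
have [N [n [c le _ E]]] := handled A e 0.
case: (classic (consistent (sub_fm (eat e n) A :: Hn n))) => [cA|iA].
  left; apply: (tr_at c (leqW le)); rewrite (sub_eatS _ c) //.
  apply: d_hyp; have := extend_in cA.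
  by rewrite -E.
right; apply: (tr_at c le); apply: d_impI; exact: NNPP.
Qed.

Lemma tr_bot G (e : env G) : ~ tr Bot e.
Proof. by case=> N /(_ N (leqnn N)); apply: consistent_stage. Qed.

Lemma tr_imp G (A B : fm G) e : tr (Imp A B) e <-> (tr A e -> tr B e).
Proof.
split=> [[N1 dAB]|AB].
  by apply: tr_map; exists N1 => n le; apply: d_impE; apply: dAB.
have [/AB|] := tr_decide A e; apply: tr_map; exists 0 => n _ d; apply: d_impI.
  exact: deriv_cons.
by apply: deriv_botE; apply: d_impE (deriv_cons _ d) (deriv_head _ _ _).
Qed.

Lemma tr_and G (A B : fm G) e : tr (And A B) e <-> tr A e /\ tr B e.
Proof.
split=> [d|[[N1 dA] [N2 dB]]].
  by split; apply: tr_map d; exists 0 => n _; [apply: d_andE1|apply: d_andE2].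
exists (maxn N1 N2) => n; rewrite geq_max => /andP[le1 le2].
by apply: d_andI; [apply: dA|apply: dB].
Qed.

Lemma tr_or G (A B : fm G) e : tr (Or A B) e <-> tr A e \/ tr B e.
Proof.
split=> [dAB|[] ]; last 2 first.
- by apply: tr_map; exists 0 => n _; apply: d_orI1.
- by apply: tr_map; exists 0 => n _; apply: d_orI2.
have [|[N1 nA]] := tr_decide A e; first by left.
right; apply: tr_map dAB; exists N1 => n le d; apply: d_orE d _ (deriv_head _ _ _).
by apply: deriv_botE; apply: d_impE (deriv_cons _ (nA n le)) (deriv_head _ _ _).
Qed.

Lemma sub_fm_econs G s (A : fm (s :: G)) (e : env G) (d : elt s) n :
  sub_fm (eat (econs d e) n) A = inst (sub_fm (up_sub (eat e n) (t := s)) A) (at_ d n).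
Proof. by rewrite inst_sub eat_econs. Qed.

Lemma tr_ex G s (A : fm (s :: G)) e : tr (Ex s A) e <-> exists d, tr A (econs d e).
Proof.
split=> [[N1 dA]|[d]]; last first.
  apply: tr_map; exists 0 => n _; rewrite sub_fm_econs; exact: d_exI.
have [N [n [c le le1 E]]] := handled (Ex s A) e N1.
(* [Ex s A] is already derivable at this stage, so adding it creates no contradiction and the new
   variable becomes its witness. *)
have cA : consistent (next_task (stages n) n :: Hn n).
  rewrite E => d; apply: (@consistent_stage n); apply: d_impE (d_impI d) (dA n le1).
have [x dx] := extend_witness E cA.
have [d [dx1 cd]] := elt_from (n0 := n.+1) x.
have c' : ecoherent (econs d e) n.+1.
  move=> m lt; rewrite !eat_econs; apply: vfun_ext; apply: var_consP; first exact: cd.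
  by move=> s' v; rewrite /= c // (leq_trans le (ltnW lt)).
exists d; apply: (tr_at c' (leqnn _)).
rewrite eat_econs dx1 (c n le) /=.
move: dx; rewrite sub_fm_comp; congr (deriv T _ (sub_fm _ A)).
apply: vfun_ext; apply: var_consP => //= s' v.
by rewrite /up_sub /= sub_tm_wk /up wkE.
Qed.

Lemma tr_all G s (A : fm (s :: G)) e : tr (All s A) e <-> forall d, tr A (econs d e).
Proof.
split=> [dA d|dA].
  move: dA; apply: tr_map; exists 0 => n _; rewrite sub_fm_econs; exact: d_allE.
(* The limit decides every formula: either some element refutes [A], or at late stages no
   counterexample is derivably possible, and [All s A] follows by reductio. *)
have [/tr_ex[d /tr_imp/(_ (dA d))/tr_bot//]|] := tr_decide (Ex s (Imp A Bot)) e.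
apply: tr_map; exists 0 => n _ /= nA; apply: d_allI; apply: d_raa.
have nA' := deriv_cons (Imp (sub_fm (up_sub (eat e n) (t := s)) A) Bot) (deriv_wk s nA).
apply: d_impE nA' _.
apply: (d_exI (A := ren_fm (up_ren (fun s v => VS _ v) (t := s)) (Imp _ Bot))
  (u := Var (VZ _ _))).
by rewrite ren_fmE -up_sub_var inst_sub (scons_eta (fun s v => @Var _ s v)) sub_fm_var;
  apply: deriv_head.
Qed.

End Henkin.

(** * Models and completeness *)

(* Equality of type 0 is interpreted by Leibniz equality, and [app_ext] makes
   the defined equality at higher types Leibniz equality as well. *)
Record model := Model {
  dom :> ty -> Type;
  app : forall s t, dom (Arr s t) -> dom s -> dom t;
  app_ext : forall s t (f g : dom (Arr s t)), (forall x, app f x = app g x) -> f = g;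
  m0 : dom tp0;
  m1 : dom tp0;
  m_plus : dom (Arr tp0 (Arr tp0 tp0));
  m_times : dom (Arr tp0 (Arr tp0 tp0));
  m_Pi : forall s t, dom (Arr s (Arr t s));
  m_Sigma : forall r s t, dom (Arr (Arr r (Arr s t)) (Arr (Arr r s) (Arr r t)));
  m_Rec : dom (Arr (Arr tp0 (Arr tp0 tp0)) (Arr tp0 (Arr tp0 tp0)));
  m_lt : dom tp0 -> dom tp0 -> Prop }.

Definition asg (M : model) (G : ctx) := forall s, var G s -> M s.
Definition anil (M : model) : asg M [::] := fun s v => vnil (fun s => M s) v.
Definition acons (M : model) G s (x : M s) (e : asg M G) : asg M (s :: G) :=
  vcase (P := M) x e.
Arguments anil {M}.

Fixpoint eval (M : model) G (e : asg M G) s (u : tm G s) : M s :=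
  match u with
  | Var s v => e s v
  | App s t f a => app (eval e f) (eval e a)
  | Zero => m0 M
  | One => m1 M
  | Plus => m_plus M
  | Times => m_times M
  | Pi s t => m_Pi M s t
  | Sigma r s t => m_Sigma M r s t
  | Rec => m_Rec M
  end.

Fixpoint sat (M : model) G (A : fm G) (e : asg M G) : Prop :=
  match A with
  | Eq0 a b => eval e a = eval e b
  | Lt0 a b => m_lt (eval e a) (eval e b)
  | Bot => False
  | And A B => sat A e /\ sat B e
  | Or A B => sat A e \/ sat B e
  | Imp A B => sat A e -> sat B e
  | All s A => forall x : M s, sat A (acons x e)
  | Ex s A => exists x : M s, sat A (acons x e)
  end.

(** * The quotient term model *)

Section TermModel.
Variable T : theory.
Hypothesis RCA_T : forall B, RCA0w B -> T B.
Variable A0 : fm [::].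
Hypothesis cA0 : consistent T [:: A0].

Notation elt := (elt T A0).
Notation env := (env T A0).
Notation tr := (@tr T A0 _).

Lemma elt_ext s (a b : elt s) : (forall n, at_ a n = at_ b n) -> a = b.
Proof.
case: a b => [u cu] [v cv] uv.
have E : u = v by apply: functional_extensionality_dep.
by case: _ / E cv uv => cv _; rewrite (proof_irrelevance _ cu cv).
Qed.

Lemma tm_elt_coherent G (e : env G) s (u : tm G s) :
  exists N, coherent (fun n => sub_tm (eat e n) u) N.
Proof.
by have [N c] := ecoherentP e; exists N => n le; apply: sub_tm_eatS c le.
Qed.

Definition tm_elt G (e : env G) s (u : tm G s) : elt s :=
  exist _ (fun n => sub_tm (eat e n) u) (tm_elt_coherent e u).

Definition nil_env : env [::] := fun s v => vnil elt v.

(** Application is the value of a term, so its coherence comes from [tm_elt_coherent]. *)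
Definition app_elt s t (f : elt (Arr s t)) (a : elt s) : elt t :=
  tm_elt (econs f (econs a nil_env)) (App v0 v1).

Lemma tm_elt_app G (e : env G) s t (f : tm G (Arr s t)) a :
  tm_elt e (App f a) = app_elt (tm_elt e f) (tm_elt e a).
Proof. exact: elt_ext. Qed.

Lemma tm_elt_wk G (e : env G) s t (d : elt t) (u : tm G s) :
  tm_elt (econs d e) (wk u) = tm_elt e u.
Proof. by apply: elt_ext => n /=; rewrite eat_econs sub_tm_wk. Qed.

Lemma tm_elt_var G (e : env G) s (v : var G s) : tm_elt e (Var v) = e s v.
Proof. exact: elt_ext. Qed.

Lemma env_eta G t (e : env (t :: G)) :
  econs (e t (VZ G t)) (fun s v => e s (VS t v)) = e.
Proof. by apply: vfun_ext; apply: var_consP. Qed.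

Lemma tr_closure G (A : fm G) : tr (closure A) nil_env -> forall e, tr A e.
Proof.
elim: G A => [|t G IH] A /=.
  by move=> trA e; rewrite (_ : e = nil_env) //; apply: vfun_ext => s v; apply: var_nilP v _.
move=> /IH trA e; rewrite -(env_eta e).
by have /(tr_all cA0) := trA (fun s v => e s (VS t v)); apply.
Qed.

Lemma tr_axiom (B : fm [::]) : T B -> tr B nil_env.
Proof.
move=> TB; exists 0 => n _; rewrite (_ : sub_fm _ B = wk_sentence B); first exact: d_axiom.
rewrite /wk_sentence ren_fmE; congr sub_fm; apply: vfun_ext => s v; exact: var_nilP v _.
Qed.

Lemma tr_RCA G (A : fm G) (e : env G) : RCA0w_axiom A -> tr A e.
Proof. by move=> AA; apply: tr_closure; apply: tr_axiom; apply: RCA_T; exists G, A. Qed.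

(** The counterpart of [eqT] on elements of the limit: [tr_eqT] relates the two. *)
Fixpoint eqv s : elt s -> elt s -> Prop :=
  match s return elt s -> elt s -> Prop with
  | tp0 => fun a b => tr (Eq0 v0 v1) (econs a (econs b nil_env))
  | Arr r t => fun f g => forall x, eqv (app_elt f x) (app_elt g x)
  end.

Lemma tr_elt G1 G2 (e1 : env G1) (e2 : env G2) (A1 : fm G1) (A2 : fm G2) :
  (forall n, sub_fm (eat e1 n) A1 = sub_fm (eat e2 n) A2) -> tr A1 e1 <-> tr A2 e2.
Proof.
by move=> E; split=> -[N d]; exists N => n le; [rewrite -E|rewrite E]; apply: d.
Qed.

Lemma tr_eqT s : forall G (e : env G) (x y : tm G s),
  tr (eqT x y) e <-> eqv (tm_elt e x) (tm_elt e y).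
Proof.
elim: s => [|r _ t IH] G e x y; first by apply: tr_elt.
rewrite [eqT _ _]/= (tr_all cA0) /=.
by split=> H d; move: (H d); rewrite IH !tm_elt_app !tm_elt_wk tm_elt_var.
Qed.

Lemma eqv_refl s (a : elt s) : eqv a a.
Proof.
elim: s a => [|r _ t IH] a /=; last by move=> x; apply: IH.
have := tr_RCA (econs a (econs a nil_env)) (ax_eq0_refl v0).
by apply: (iffLR (tr_elt _)) => n.
Qed.

Lemma eqv_sym s (a b : elt s) : eqv a b -> eqv b a.
Proof.
elim: s a b => [|r _ t IH] a b /=; last by move=> ab x; apply: IH.
have /tr_imp S := tr_RCA (econs a (econs b nil_env)) (ax_eq0_sym v0 v1).
by move=> /S; apply: (iffLR (tr_elt _)) => n.
Qed.

Lemma eqv_trans s (a b c : elt s) : eqv a b -> eqv b c -> eqv a c.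
Proof.
elim: s a b c => [|r _ t IH] a b c /=; last by move=> ab bc x; apply: IH (ab x) (bc x).
pose e := econs a (econs b (econs c nil_env)).
have /tr_imp S := tr_RCA e (ax_eq0_trans v0 v1 v2).
move=> ab bc; have {}ab : tr (Eq0 v0 v1) e by move: ab; apply: (iffLR (tr_elt _)).
have {}bc : tr (Eq0 v1 v2) e by move: bc; apply: (iffLR (tr_elt _)).
have /tr_imp/(_ bc) := S ab.
by apply: (iffLR (tr_elt _)) => n.
Qed.

Lemma eqv_app s t (f g : elt (Arr s t)) (a b : elt s) :
  eqv f g -> eqv a b -> eqv (app_elt f a) (app_elt g b).
Proof.
move=> fg ab; apply: eqv_trans (fg a) _.
pose e := econs a (econs b (econs g nil_env)).
(* A change of function is covered by the definition of [eqv]; a change of argument needs the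
   extensionality axiom. *)
have /tr_imp := tr_RCA e (ax_extensionality v0 v1 v2).
by rewrite !tr_eqT !tm_elt_app !tm_elt_var; apply.
Qed.

(** A class is represented by its membership predicate, so that equality of classes is Leibniz
    equality by functional and propositional extensionality and proof irrelevance. *)
Definition quo s := {P : elt s -> Prop | exists d, P = eqv d}.
Definition cls s (d : elt s) : quo s := exist _ (eqv d) (ex_intro _ d erefl).

Lemma clsP s (d d' : elt s) : cls d = cls d' <-> eqv d d'.
Proof.
split=> [[->]|dd']; first exact: eqv_refl.
have E : eqv d = eqv d'.
  apply: functional_extensionality => x; apply: propositional_extensionality.
  by split; apply: eqv_trans => //; apply: eqv_sym.
rewrite /cls; move: (ex_intro _ _ _) (ex_intro _ _ _); rewrite E => p q.
by rewrite (proof_irrelevance _ p q).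
Qed.

Lemma cls_surj s (x : quo s) : exists d, cls d = x.
Proof.
case: x => P p; have [d E] := p; subst P; exists d; rewrite /cls.
by rewrite (proof_irrelevance _ p (ex_intro _ d erefl)).
Qed.

Definition repr s (x : quo s) : elt s :=
  proj1_sig (constructive_indefinite_description _ (cls_surj x)).

Lemma reprK s : cancel (@repr s) (@cls s).
Proof. by move=> x; rewrite /repr; case: constructive_indefinite_description. Qed.

Definition quo_app s t (f : quo (Arr s t)) (x : quo s) : quo t :=
  cls (app_elt (repr f) (repr x)).

Lemma cls_app s t (f : elt (Arr s t)) (x : elt s) :
  quo_app (cls f) (cls x) = cls (app_elt f x).
Proof. by apply/clsP; apply: eqv_app; apply/clsP; rewrite reprK. Qed.

Lemma quo_ext s t (f g : quo (Arr s t)) : (forall x, quo_app f x = quo_app g x) -> f = g.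
Proof.
rewrite -(reprK f) -(reprK g) => fg; apply/clsP => x.
by apply/clsP; rewrite -!cls_app.
Qed.

Definition quo_cst s (u : tm [::] s) : quo s := cls (tm_elt nil_env u).

Definition term_model : model :=
  @Model quo quo_app quo_ext (quo_cst Zero) (quo_cst One) (quo_cst Plus) (quo_cst Times)
    (fun s t => quo_cst (Pi s t)) (fun r s t => quo_cst (Sigma r s t)) (quo_cst Rec)
    (fun x y => tr (Lt0 v0 v1) (econs (repr x) (econs (repr y) nil_env))).

Definition cls_env G (e : env G) : asg term_model G := fun s v => cls (e s v).

Lemma cls_econs G s (d : elt s) (e : env G) :
  cls_env (econs d e) = acons (cls d : term_model s) (cls_env e).
Proof. by apply: vfun_ext; apply: var_consP. Qed.

Lemma eval_cls G (e : env G) s (u : tm G s) : eval (cls_env e) u = cls (tm_elt e u).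
Proof.
elim: u => [{}s v|{}s t f /= -> a ->|||||{}s t|r {}s t|] /=;
  first (by rewrite tm_elt_var); first (by rewrite cls_app -tm_elt_app);
  by rewrite /quo_cst; congr cls; apply: elt_ext.
Qed.

Lemma tr_lt_congr (a a' b b' : elt tp0) : eqv a a' -> eqv b b' ->
  tr (Lt0 v0 v1) (econs a (econs b nil_env)) -> tr (Lt0 v0 v1) (econs a' (econs b' nil_env)).
Proof.
pose e := econs a (econs a' (econs b (econs b' nil_env))).
have /tr_imp S := tr_RCA e (ax_lt0_congr v0 v1 v2 v3).
move=> aa bb; have {}aa : tr (Eq0 v0 v1) e by move: aa; apply: (iffLR (tr_elt _)).
have {}bb : tr (Eq0 v2 v3) e by move: bb; apply: (iffLR (tr_elt _)).
have /tr_imp/(_ bb)/tr_imp L := S aa.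
move=> ab; have {}ab : tr (Lt0 v0 v2) e by move: ab; apply: (iffLR (tr_elt _)).
by move: (L ab); apply: (iffLR (tr_elt _)).
Qed.

Lemma truth G (A : fm G) : forall e : env G, sat A (cls_env e) <-> tr A e.
Proof.
elim: A => {G} [G a b|G a b|G|G A IA B IB|G A IA B IB|G A IA B IB|G s A IA|G s A IA] e.
- by rewrite /= !eval_cls clsP -tr_eqT.
- rewrite /= !eval_cls.
  have E : tr (Lt0 a b) e <-> tr (Lt0 v0 v1) (econs (tm_elt e a) (econs (tm_elt e b) nil_env)).
    by apply: tr_elt.
  by rewrite E; split; apply: tr_lt_congr; apply/clsP; rewrite reprK.
- by split=> // /(tr_bot cA0).
- by rewrite tr_and /= IA IB.
- by rewrite tr_or /= IA IB.
- by rewrite tr_imp /= IA IB.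
- rewrite (tr_all cA0) /=; split=> H d.
    by rewrite -IA cls_econs; apply: H.
  by have [d' <-] := cls_surj d; rewrite -cls_econs IA.
- rewrite (tr_ex cA0) /=; split=> -[d H].
    have [d' E] := cls_surj d; exists d'; rewrite -IA cls_econs E //.
  by exists (cls d); rewrite -cls_econs IA.
Qed.

Lemma term_model_sat B : T B \/ B = A0 -> sat B (anil (M := term_model)).
Proof.
have -> : anil = cls_env nil_env.
  by apply: vfun_ext => s v; apply: var_nilP v _.
move=> TB; apply/truth; case: TB => [/tr_axiom //|->].
exists 0 => n _; apply: d_hyp.
elim: n => [|n IH].
  left; rewrite (_ : eat nil_env 0 = fun s v => Var v) ?sub_fm_var //.
  by apply: vfun_ext => s v; apply: var_nilP v _.
have c : ecoherent nil_env 0.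
  by move=> m _; apply: vfun_ext => s v; apply: var_nilP v _.
rewrite (sub_eatS A0 c (leq0n n)); exact: extend_sub.
Qed.
End TermModel.

(** The inclusion of [RCA0w] in [T] supplies the equality and extensionality axioms on which the
    quotient of the term model rests; hence models with Leibniz equality suffice. *)
Theorem completeness (T : theory) (A : fm [::]) : (forall B, RCA0w B -> T B) ->
  (forall M : model, (forall B, T B -> sat B (anil (M := M))) -> sat A (anil (M := M))) ->
  proves T A.
Proof.
move=> RT MA; apply: NNPP => nA.
have cA : consistent T [:: Imp A Bot] by move=> d; apply: nA; apply: d_raa.
pose sA := term_model_sat RT cA.
have /MA A_ : forall B, T B -> sat B (anil (M := term_model RT cA)).
  by move=> B TB; apply: sA; left.
by have := sA (Imp A Bot) (or_intror erefl); apply.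
Qed.

(** * The ordered field of fractions of a discretely ordered semiring *)

(** [ds_sub] yields a successor because denominators have the form [c + 1]; this is what makes
    nonzero fractions invertible. *)
Record discrete_semiring := DiscreteSemiring {
  ds_sort :> comNzSemiRingType;
  ds_lt : ds_sort -> ds_sort -> Prop;
  ds_irr : forall x, ~ ds_lt x x;
  ds_trans : forall x y z, ds_lt x y -> ds_lt y z -> ds_lt x z;
  ds_total : forall x y, ds_lt x y \/ x = y \/ ds_lt y x;
  ds_add : forall x y z, ds_lt x y -> ds_lt (x + z)%R (y + z)%R;
  ds_mul : forall x y z, ds_lt 0%R z -> ds_lt x y -> ds_lt (x * z)%R (y * z)%R;
  ds_succ_pos : forall x, ds_lt 0%R (x + 1)%R;
  ds_sub : forall x y, ds_lt x y -> exists z, y = (x + z + 1)%R }.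

Section Fractions.
Variable N : discrete_semiring.
Local Open Scope ring_scope.
Implicit Types (x y z a b c : N).

Local Notation "x <N y" := (ds_lt x y) (at level 70).

Lemma ds_addI z x y : x + z = y + z -> x = y.
Proof.
move=> E; have [/(ds_add z)|[//|/(ds_add z)]] := ds_total x y;
  by rewrite E => /ds_irr.
Qed.

Lemma ds_add_lt z x y : x + z <N y + z -> x <N y.
Proof.
move=> L; have [//|[xy|/(ds_add z) G]] := ds_total x y.
  by move: L; rewrite xy => /ds_irr.
by have /ds_irr := ds_trans L G.
Qed.

Lemma ds_mulI z x y : x * (z + 1) = y * (z + 1) -> x = y.
Proof.
move=> E; have [|[//|]] := ds_total x y => /(ds_mul (ds_succ_pos z));
  by rewrite E => /ds_irr.
Qed.

Lemma ds_mul_lt z x y : x * (z + 1) <N y * (z + 1) -> x <N y.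
Proof.
move=> L; have [//|[xy|/(ds_mul (ds_succ_pos z)) G]] := ds_total x y.
  by move: L; rewrite xy => /ds_irr.
by have /ds_irr := ds_trans L G.
Qed.

Lemma ds_add2 x y x' y' : x <N y -> x' <N y' -> x + x' <N y + y'.
Proof.
move=> /(ds_add x') L /(ds_add y); rewrite addrC [y' + y]addrC; exact: ds_trans.
Qed.

(* [((a, b), c)] stands for [(a - b) / (c + 1)], as in the codes of rationals *)
Definition prefrac : Type := N * N * N.

Definition fr_eqv (p q : prefrac) :=
  let: (a, b, c) := p in let: (a', b', c') := q in
  a * (c' + 1) + b' * (c + 1) = a' * (c + 1) + b * (c' + 1).

Lemma fr_eqv_refl p : fr_eqv p p.
Proof. by case: p => [[a b] c]. Qed.

Lemma fr_eqv_sym p q : fr_eqv p q -> fr_eqv q p.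
Proof. by case: p q => [[a b] c] [[a' b'] c'] /= ->. Qed.

Lemma fr_eqv_trans p q r : fr_eqv p q -> fr_eqv q r -> fr_eqv p r.
Proof.
case: p q r => [[a1 b1] c1] [[a2 b2] c2] [[a3 b3] c3] /= E1 E2.
(* Without subtraction, the middle fraction is eliminated by cancellation: the factor [c2 + 1] and
   the added cross terms turn the goal into a combination of [E1] and [E2]. *)
apply: (@ds_mulI c2); apply: (@ds_addI (b2 * (c1 + 1) * (c3 + 1) + a2 * (c1 + 1) * (c3 + 1))).
transitivity ((a1 * (c2 + 1) + b2 * (c1 + 1)) * (c3 + 1)
   + (a2 * (c3 + 1) + b3 * (c2 + 1)) * (c1 + 1)); first by ring.
by rewrite E1 E2; ring.
Qed.

Definition frac := {P : prefrac -> Prop | exists p, P = fr_eqv p}.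
Definition fr (p : prefrac) : frac := exist _ (fr_eqv p) (ex_intro _ p erefl).

Lemma frP p q : fr p = fr q <-> fr_eqv p q.
Proof.
split=> [[->]|pq]; first exact: fr_eqv_refl.
have E : fr_eqv p = fr_eqv q.
  apply: functional_extensionality => x; apply: propositional_extensionality.
  by split; apply: fr_eqv_trans => //; apply: fr_eqv_sym.
rewrite /fr; move: (ex_intro _ _ _) (ex_intro _ _ _); rewrite E => e1 e2.
by rewrite (proof_irrelevance _ e1 e2).
Qed.

Lemma fr_surj (x : frac) : exists p, fr p = x.
Proof.
case: x => P e; have [p E] := e; subst P; exists p; rewrite /fr.
by rewrite (proof_irrelevance _ e (ex_intro _ p erefl)).
Qed.

Definition fr_repr (x : frac) : prefrac :=
  proj1_sig (constructive_indefinite_description _ (fr_surj x)).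

Lemma fr_reprK : cancel fr_repr fr.
Proof. by move=> x; rewrite /fr_repr; case: constructive_indefinite_description. Qed.

Lemma fr_repr_eqv p : fr_eqv (fr_repr (fr p)) p.
Proof. by apply/frP; rewrite fr_reprK. Qed.

Definition pre_add (p q : prefrac) : prefrac :=
  let: (a, b, c) := p in let: (a', b', c') := q in
  (a * (c' + 1) + a' * (c + 1), b * (c' + 1) + b' * (c + 1), c * c' + c + c').
Definition pre_mul (p q : prefrac) : prefrac :=
  let: (a, b, c) := p in let: (a', b', c') := q in
  (a * a' + b * b', a * b' + b * a', c * c' + c + c').
Definition pre_opp (p : prefrac) : prefrac := let: (a, b, c) := p in (b, a, c).

Definition fr_add (x y : frac) := fr (pre_add (fr_repr x) (fr_repr y)).
Definition fr_mul (x y : frac) := fr (pre_mul (fr_repr x) (fr_repr y)).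
Definition fr_opp (x : frac) := fr (pre_opp (fr_repr x)).

Lemma fr_addE p q : fr_add (fr p) (fr q) = fr (pre_add p q).
Proof.
apply/frP; move: (fr_repr_eqv p) (fr_repr_eqv q).
case: (fr_repr _) => [[a1 b1] c1]; case: (fr_repr _) => [[a2 b2] c2].
case: p q => [[a1' b1'] c1'] [[a2' b2'] c2'] /= E1 E2.
transitivity ((a1 * (c1' + 1) + b1' * (c1 + 1)) * (c2 + 1) * (c2' + 1) +
  (a2 * (c2' + 1) + b2' * (c2 + 1)) * (c1 + 1) * (c1' + 1)); first by ring.
by rewrite E1 E2; ring.
Qed.

Lemma fr_oppE p : fr_opp (fr p) = fr (pre_opp p).
Proof.
apply/frP; move: (fr_repr_eqv p).
case: (fr_repr _) => [[a1 b1] c1]; case: p => [[a2 b2] c2] /= E.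
by rewrite addrC -E addrC.
Qed.

Lemma fr_mulE p q : fr_mul (fr p) (fr q) = fr (pre_mul p q).
Proof.
have mul_l p1 p2 r : fr_eqv p1 p2 -> fr_eqv (pre_mul p1 r) (pre_mul p2 r).
  case: p1 p2 r => [[a1 b1] c1] [[a2 b2] c2] [[a b] c] /= E.
  transitivity ((a1 * (c2 + 1) + b2 * (c1 + 1)) * (c + 1) * a +
    (a2 * (c1 + 1) + b1 * (c2 + 1)) * (c + 1) * b); first by ring.
  by rewrite E -{2}E; ring.
have mulC p1 p2 : pre_mul p1 p2 = pre_mul p2 p1.
  case: p1 p2 => [[a1 b1] c1] [[a2 b2] c2] /=.
  by congr (_, _, _); ring.
apply/frP; apply: fr_eqv_trans (mul_l _ _ _ (fr_repr_eqv p)) _.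
by rewrite ![pre_mul p _]mulC; apply: mul_l; apply: fr_repr_eqv.
Qed.

HB.instance Definition _ := boolp.gen_eqMixin frac.
HB.instance Definition _ := boolp.gen_choiceMixin frac.

Ltac frac_ring :=
  rewrite ?(fr_addE, fr_mulE, fr_oppE); apply/frP => /=; ring.

Lemma fr_addA : associative fr_add.
Proof.
move=> x y z; have [[[a1 b1] c1] <-] := fr_surj x; have [[[a2 b2] c2] <-] := fr_surj y.
by have [[[a3 b3] c3] <-] := fr_surj z; frac_ring.
Qed.

Lemma fr_addC : commutative fr_add.
Proof.
move=> x y; have [[[a1 b1] c1] <-] := fr_surj x; have [[[a2 b2] c2] <-] := fr_surj y.
frac_ring.
Qed.

Definition fr0 := fr (0, 0, 0).
Definition fr1 := fr (1, 0, 0).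

Lemma fr_add0 : left_id fr0 fr_add.
Proof. move=> x; have [[[a b] c] <-] := fr_surj x; rewrite /fr0; frac_ring. Qed.

Lemma fr_addN : left_inverse fr0 fr_opp fr_add.
Proof. move=> x; have [[[a b] c] <-] := fr_surj x; rewrite /fr0; frac_ring. Qed.

HB.instance Definition _ := GRing.isZmodule.Build frac fr_addA fr_addC fr_add0 fr_addN.

Lemma fr_mulA : associative fr_mul.
Proof.
move=> x y z; have [[[a1 b1] c1] <-] := fr_surj x; have [[[a2 b2] c2] <-] := fr_surj y.
by have [[[a3 b3] c3] <-] := fr_surj z; frac_ring.
Qed.

Lemma fr_mulC : commutative fr_mul.
Proof.
move=> x y; have [[[a1 b1] c1] <-] := fr_surj x; have [[[a2 b2] c2] <-] := fr_surj y.
frac_ring.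
Qed.

Lemma fr_mul1 : left_id fr1 fr_mul.
Proof. move=> x; have [[[a b] c] <-] := fr_surj x; rewrite /fr1; frac_ring. Qed.

Lemma fr_mulDl : left_distributive fr_mul (@GRing.add frac).
Proof.
move=> x y z; have [[[a1 b1] c1] <-] := fr_surj x; have [[[a2 b2] c2] <-] := fr_surj y.
have [[[a3 b3] c3] <-] := fr_surj z; rewrite -[(_ + _ : frac)]/(fr_add _ _).
rewrite -[(fr_mul _ _ + _ : frac)]/(fr_add _ _); frac_ring.
Qed.

Lemma fr1_neq0 : fr1 != 0 :> frac.
Proof.
apply/eqP => /frP /= E; apply: (@ds_irr N 0).
have {2}-> : 0 = 0 + 1 :> N; last exact: ds_succ_pos.
transitivity (0 * (0 + 1) + 0 * (0 + 1) : N); first by ring.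
by rewrite -E; ring.
Qed.

HB.instance Definition _ :=
  GRing.Zmodule_isComNzRing.Build frac fr_mulA fr_mulC fr_mul1 fr_mulDl fr1_neq0.

Lemma fr_inv_exists (x : frac) : exists y : frac, (x != 0 -> y * x = 1) /\ (x = 0 -> y = 0).
Proof.
have [->|x0] := eqVneq x 0; first by exists 0.
have [[[a b] c] E] := fr_surj x.
have [L|[ab|L]] := ds_total a b.
(* Here [b = a + d + 1], so the fraction is negative with inverse [-(c + 1) / (d + 1)]. *)
- have [d Ed] := ds_sub L; exists (fr (0, c + 1, d)).
  split=> [_|/eqP]; last by rewrite (negbTE x0).
  by rewrite -E -[LHS]/(fr_mul _ _) fr_mulE; apply/frP => /=; rewrite Ed; ring.
- by case/eqP: x0; rewrite -E; apply/frP => /=; rewrite ab; ring.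
- have [d Ed] := ds_sub L; exists (fr (c + 1, 0, d)).
  split=> [_|/eqP]; last by rewrite (negbTE x0).
  by rewrite -E -[LHS]/(fr_mul _ _) fr_mulE; apply/frP => /=; rewrite Ed; ring.
Qed.

Definition fr_inv (x : frac) : frac :=
  proj1_sig (constructive_indefinite_description _ (fr_inv_exists x)).

Lemma fr_mulVf (x : frac) : x != 0 -> fr_inv x * x = 1.
Proof. by rewrite /fr_inv; case: constructive_indefinite_description => y [/= ]. Qed.

Lemma fr_inv0 : fr_inv 0 = 0.
Proof. by rewrite /fr_inv; case: constructive_indefinite_description => y [/= _ ->]. Qed.

HB.instance Definition _ := GRing.ComNzRing_isField.Build frac fr_mulVf fr_inv0.

Definition fr_nonneg (x : frac) : bool :=
  let: (a, b, c) := fr_repr x in boolp.asbool (~ a <N b).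

Lemma fr_nonnegP a b c : reflect (~ a <N b) (fr_nonneg (fr (a, b, c))).
Proof.
rewrite /fr_nonneg; move: (fr_repr_eqv (a, b, c)); case: (fr_repr _) => [[a' b'] c'] /= E.
apply: (iffP (boolp.asboolP _)) => nL L; apply: nL.
  apply: (@ds_mul_lt c); apply: (@ds_add_lt (b * (c' + 1))); rewrite E.
  by rewrite [X in _ <N X]addrC; apply: ds_add; apply: ds_mul => //; apply: ds_succ_pos.
apply: (@ds_mul_lt c'); apply: (@ds_add_lt (b' * (c + 1))); rewrite -E.
by rewrite [X in _ <N X]addrC; apply: ds_add; apply: ds_mul => //; apply: ds_succ_pos.
Qed.

Definition fr_le (x y : frac) := fr_nonneg (y - x).
Definition fr_lt (x y : frac) := (y != x) && fr_le x y.
Definition fr_norm (x : frac) := if fr_nonneg x then x else - x.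

Lemma fr_le0E (x : frac) : fr_le 0 x = fr_nonneg x.
Proof. by rewrite /fr_le subr0. Qed.

Lemma fr_nonneg_opp a b c : reflect (~ b <N a) (fr_nonneg (- fr (a, b, c))).
Proof. by rewrite -[(- _ : frac)]/(fr_opp _) fr_oppE; apply: fr_nonnegP. Qed.

Lemma nlt_add x y x' y' : ~ x <N y -> ~ x' <N y' -> ~ x + x' <N y + y'.
Proof.
move=> nL nL' L.
have [//|[E|G]] := ds_total x y.
  by apply: nL'; move: L; rewrite E addrC [y + y']addrC => /ds_add_lt.
have [//|[E|G']] := ds_total x' y'; first by apply: nL; move: L; rewrite E => /ds_add_lt.
by have /ds_irr := ds_trans L (ds_add2 G G').
Qed.

Lemma nlt_mul z x y : ~ x <N y -> ~ x * (z + 1) <N y * (z + 1).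
Proof. by move=> nL /ds_mul_lt. Qed.

Lemma fr_le0_add (x y : frac) : fr_le 0 x -> fr_le 0 y -> fr_le 0 (x + y).
Proof.
have [[[a1 b1] c1] <-] := fr_surj x; have [[[a2 b2] c2] <-] := fr_surj y.
rewrite !fr_le0E -[(_ + _ : frac)]/(fr_add _ _) fr_addE.
by move=> /fr_nonnegP p /fr_nonnegP q; apply/fr_nonnegP; apply: nlt_add; apply: nlt_mul.
Qed.

Lemma nlt_sub x y : ~ x <N y -> exists z, x = y + z.
Proof.
move=> nL; have [//|[->|/ds_sub[z ->]]] := ds_total x y; first by exists 0; rewrite addr0.
by exists (z + 1); rewrite addrA.
Qed.

Lemma ds_nlt0 x : ~ x <N 0.
Proof.
by move=> /ds_sub [z E]; apply: (@ds_irr N 0); rewrite {2}E; apply: ds_succ_pos.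
Qed.

Lemma fr_le0_mul (x y : frac) : fr_le 0 x -> fr_le 0 y -> fr_le 0 (x * y).
Proof.
have [[[a1 b1] c1] <-] := fr_surj x; have [[[a2 b2] c2] <-] := fr_surj y.
rewrite !fr_le0E -[(_ * _ : frac)]/(fr_mul _ _) fr_mulE.
move=> /fr_nonnegP /nlt_sub[z1 ->] /fr_nonnegP /nlt_sub[z2 ->]; apply/fr_nonnegP.
(* Once each numerator difference is a number [z1] or [z2], that of the product is [z1 * z2], which
   is not below 0. *)
rewrite (_ : (b1 + z1) * (b2 + z2) + b1 * b2 = z1 * z2 + ((b1 + z1) * b2 + b1 * (b2 + z2))).
  by rewrite -[X in _ <N X]add0r => /ds_add_lt /ds_nlt0.
by ring.
Qed.

Lemma fr_le0_anti (x : frac) : fr_le 0 x -> fr_le x 0 -> x = 0.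
Proof.
have [[[a b] c] <-] := fr_surj x; rewrite fr_le0E /fr_le sub0r.
move=> /fr_nonnegP n1 /fr_nonneg_opp n2; have [//|[->|//]] := ds_total a b.
by apply/frP => /=; ring.
Qed.

Lemma fr_sub_ge0 (x y : frac) : fr_le 0 (y - x) = fr_le x y.
Proof. exact: fr_le0E. Qed.

Lemma fr_le0_total (x : frac) : fr_le 0 x || fr_le x 0.
Proof.
have [[[a b] c] <-] := fr_surj x; rewrite fr_le0E /fr_le sub0r.
have [L|nL] := classic (a <N b); last by apply/orP; left; apply/fr_nonnegP.
by apply/orP; right; apply/fr_nonneg_opp => /(ds_trans L)/ds_irr.
Qed.

Lemma fr_normN (x : frac) : fr_norm (- x) = fr_norm x.
Proof.
rewrite /fr_norm; have := fr_le0_total x; have := @fr_le0_anti x.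
rewrite /fr_le sub0r subr0; case: (fr_nonneg x) => /=; last by move=> _ ->.
by case: (fr_nonneg (- x)) => [/(_ isT isT) ->|]; rewrite ?oppr0 ?opprK.
Qed.

Lemma fr_ge0_norm (x : frac) : fr_le 0 x -> fr_norm x = x.
Proof. by rewrite fr_le0E /fr_norm => ->. Qed.

Lemma fr_lt_def (x y : frac) : fr_lt x y = (y != x) && fr_le x y.
Proof. by []. Qed.

HB.instance Definition _ := Num.IntegralDomain_isLeReal.Build frac
  fr_le0_add fr_le0_mul fr_le0_anti fr_sub_ge0 fr_le0_total fr_normN fr_ge0_norm fr_lt_def.

Definition to_frac (x : N) : frac := fr (x, 0, 0).

Lemma to_fracD x y : to_frac (x + y) = to_frac x + to_frac y.
Proof. by rewrite -[RHS]/(fr_add _ _) fr_addE; apply/frP => /=; ring. Qed.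

Lemma to_fracM x y : to_frac (x * y) = to_frac x * to_frac y.
Proof. by rewrite -[RHS]/(fr_mul _ _) fr_mulE; apply/frP => /=; ring. Qed.

Lemma to_frac0 : to_frac 0 = 0. Proof. by []. Qed.

Lemma to_frac_lt x y : ds_lt x y <-> to_frac x < to_frac y.
Proof.
have nP : fr_le (to_frac y) (to_frac x) <-> ~ x <N y.
  have -> : fr_le (to_frac y) (to_frac x) = fr_nonneg (fr (x, y, 0)).
    by congr fr_nonneg; rewrite /to_frac -[LHS]/(fr_add _ (fr_opp _)); frac_ring.
  by split=> [/fr_nonnegP|H] //; apply/fr_nonnegP.
rewrite ltNge -[(_ <= _)]/(fr_le _ _); split=> [L|]; first by apply/negP => /nP.
by move=> /negP H; apply: NNPP => /nP.
Qed.

Lemma to_frac_inj : injective to_frac.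
Proof.
move=> x y E; have [/to_frac_lt|[//|/to_frac_lt]] := ds_total x y; by rewrite E ltxx.
Qed.

Lemma to_frac_ge0 x : 0 <= to_frac x.
Proof. by rewrite -to_frac0 leNgt; apply/negP => /to_frac_lt/ds_nlt0. Qed.

End Fractions.

(** * Models of the base theory *)

Record rca_model := RCAModel {
  rca_mod :> model;
  rca_sat : forall B, RCA0w B -> sat B (anil (M := rca_mod)) }.

Definition num (M : rca_model) : Type := M tp0.

Section Evaluation.
Variable M : rca_model.
Implicit Types G : ctx.

Lemma asg_eta G t (e : asg M (t :: G)) :
  acons (e t (VZ G t)) (fun s v => e s (VS t v)) = e.
Proof. by apply: vfun_ext; apply: var_consP. Qed.

Lemma eval_sub G G' (f : sub G G') s (u : tm G s) (e : asg M G') :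
  eval e (sub_tm f u) = eval (fun s v => eval e (f s v)) u.
Proof. by elim: u => //= {}s t g -> a ->. Qed.

Lemma eval_wk G t s (u : tm G s) (x : M t) (e : asg M G) :
  eval (acons x e) (wk u) = eval e u.
Proof. by rewrite wkE eval_sub. Qed.

Lemma asg_scons G G' t (a : tm G' t) (f : sub G G') (e : asg M G') :
  (fun s v => eval e ((scons a f) s v)) = acons (eval e a) (fun s v => eval e (f s v)).
Proof. by apply: vfun_ext; apply: var_consP. Qed.

Lemma asg_up_sub G G' t (f : sub G G') (x : M t) (e : asg M G') :
  (fun s v => eval (acons x e) ((up_sub f (t := t)) s v)) =
  acons x (fun s v => eval e (f s v)).
Proof.
by apply: vfun_ext; apply: var_consP => //= s v; rewrite /up_sub /= eval_wk.
Qed.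

Lemma sat_sub G (A : fm G) : forall G' (f : sub G G') (e : asg M G'),
  sat (sub_fm f A) e <-> sat A (fun s v => eval e (f s v)).
Proof.
elim: A => {G} [G a b|G a b|G|G A IA B IB|G A IA B IB|G A IA B IB|G s A IA|G s A IA] G' f e /=.
- by rewrite !eval_sub.
- by rewrite !eval_sub.
- by [].
- by rewrite IA IB.
- by rewrite IA IB.
- by rewrite IA IB.
- by split=> H x; move: (H x); rewrite IA asg_up_sub.
- by split=> -[x H]; exists x; move: H; rewrite IA asg_up_sub.
Qed.

Lemma sat_closure G (A : fm G) : sat (closure A) (anil (M := M)) -> forall e : asg M G, sat A e.
Proof.
elim: G A => [|t G IH] A /=.
  by move=> sA e; rewrite (_ : e = anil) //; apply: vfun_ext => s v; apply: var_nilP v _.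
by move=> /IH sA e; rewrite -(asg_eta e); apply: sA.
Qed.

Lemma sat_axiom G (A : fm G) (e : asg M G) : RCA0w_axiom A -> sat A e.
Proof. by move=> AA; apply: sat_closure; apply: rca_sat; exists G, A. Qed.

Lemma sat_eqT s : forall G (e : asg M G) (x y : tm G s),
  sat (eqT x y) e <-> eval e x = eval e y.
Proof.
elim: s => // r _ t IH G e x y.
rewrite [eqT _ _]/= /=; split=> [H|E z]; last by rewrite IH /= !eval_wk E.
by apply: app_ext => z; move: (H z); rewrite IH /= !eval_wk.
Qed.

Notation asg2 x y := (acons x (acons y anil)).
Notation asg3 x y z := (acons x (acons y (acons z anil))).

Lemma app_Pi s t (x : M s) (y : M t) : app (app (m_Pi M s t) x) y = x.
Proof. by have /sat_eqT := sat_axiom (asg2 x y) (ax_Pi_def v0 v1). Qed.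

Lemma app_Sigma r s t (x : M (Arr r (Arr s t))) (y : M (Arr r s)) (z : M r) :
  app (app (app (m_Sigma M r s t) x) y) z = app (app x z) (app y z).
Proof. by have /sat_eqT := sat_axiom (asg3 x y z) (ax_Sigma_def v0 v1 v2). Qed.

Lemma eval_lam r G t (u : tm (r :: G) t) (x : M r) (e : asg M G) :
  app (eval e (lam u)) x = eval (acons x e) u.
Proof.
elim: u => /= [s v|s t' f <- a <-|||||s t'|r' s t'|]; rewrite ?app_Pi ?app_Sigma //.
move: s v; apply: var_consP => [|s v] /=; first by rewrite app_Sigma app_Pi.
by rewrite app_Pi.
Qed.

Lemma qf_ind G (A : fm (tp0 :: G)) (e : asg M G) : qf A ->
  sat A (acons (m0 M) e) ->
  (forall n : M tp0, sat A (acons n e) -> sat A (acons (app (app (m_plus M) n) (m1 M)) e)) ->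
  forall n : M tp0, sat A (acons n e).
Proof.
move=> qA A0 AS; have /= ind := sat_axiom e (ax_QF_induction qA).
apply: ind => [|n].
  by apply/sat_sub; rewrite asg_scons.
move=> /AS An; apply/sat_sub; rewrite asg_scons.
by rewrite (_ : (fun s v => _) = e) //; apply: vfun_ext.
Qed.

End Evaluation.

(** * The semiring of numbers of a model and primitive recursion in it *)

Section Semiring.
Variable M : rca_model.

HB.instance Definition _ := boolp.gen_eqMixin (num M).
HB.instance Definition _ := boolp.gen_choiceMixin (num M).

Definition n_add (x y : num M) : num M := app (app (m_plus M) x) y.
Definition n_mul (x y : num M) : num M := app (app (m_times M) x) y.
Definition n_lt (x y : num M) : Prop := m_lt (x : M tp0) y.
Notation n0 := (m0 M : num M).
Notation n1 := (m1 M : num M).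
Notation asg1 x := (acons (x : M tp0) anil).
Notation asg2 x y := (acons (x : M tp0) (asg1 y)).
Notation asg3 x y z := (acons (x : M tp0) (asg2 y z)).

Lemma n_addA : associative n_add.
Proof. by move=> x y z; have := sat_axiom (asg3 x y z) (ax_addA v0 v1 v2). Qed.
Lemma n_addC : commutative n_add.
Proof. by move=> x y; have := sat_axiom (asg2 x y) (ax_addC v0 v1). Qed.
Lemma n_add0 : left_id n0 n_add.
Proof. by move=> x; rewrite n_addC; have := sat_axiom (asg1 x) (ax_add0 v0). Qed.
Lemma n_mulA : associative n_mul.
Proof. by move=> x y z; have := sat_axiom (asg3 x y z) (ax_mulA v0 v1 v2). Qed.
Lemma n_mulC : commutative n_mul.
Proof. by move=> x y; have := sat_axiom (asg2 x y) (ax_mulC v0 v1). Qed.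
Lemma n_mul1 : left_id n1 n_mul.
Proof. by move=> x; rewrite n_mulC; have := sat_axiom (asg1 x) (ax_mul1 v0). Qed.
Lemma n_mul0 : left_zero n0 n_mul.
Proof. by move=> x; rewrite n_mulC; have := sat_axiom (asg1 x) (ax_mul0 v0). Qed.
Lemma n_mulDl : left_distributive n_mul n_add.
Proof.
move=> x y z; rewrite ![n_mul _ z]n_mulC.
by have := sat_axiom (asg3 z x y) (ax_mulDr v0 v1 v2).
Qed.
Lemma n_irr x : ~ n_lt x x.
Proof. exact: (sat_axiom (asg1 x) (ax_lt_irr v0)). Qed.
Lemma n_lt01 : n_lt n0 n1.
Proof. exact: (sat_axiom (anil (M := M)) (ax_lt01 _)). Qed.
Lemma n1_neq0 : n1 != n0.
Proof. by apply/eqP => E; apply: (@n_irr n0); rewrite -{2}E; apply: n_lt01. Qed.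

HB.instance Definition _ := GRing.isNmodule.Build (num M) n_addA n_addC n_add0.
HB.instance Definition _ := GRing.Nmodule_isComNzSemiRing.Build (num M)
  n_mulA n_mulC n_mul1 n_mulDl n_mul0 n1_neq0.

Lemma n_trans x y z : n_lt x y -> n_lt y z -> n_lt x z.
Proof. exact: (sat_axiom (asg3 x y z) (ax_lt_trans v0 v1 v2)). Qed.
Lemma n_total x y : n_lt x y \/ x = y \/ n_lt y x.
Proof. exact: (sat_axiom (asg2 x y) (ax_lt_total v0 v1)). Qed.
Local Open Scope ring_scope.
Lemma n_lt_add (x y z : num M) : n_lt x y -> n_lt (x + z) (y + z).
Proof. exact: (sat_axiom (asg3 x y z) (ax_lt_add v0 v1 v2)). Qed.
Lemma n_lt_mul (x y z : num M) : n_lt 0 z -> n_lt x y -> n_lt (x * z) (y * z).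
Proof. exact: (sat_axiom (asg3 x y z) (ax_lt_mul v0 v1 v2)). Qed.

(** In a step term [u], variable 0 is the previous value and variable 1 the recursion index. *)
Lemma rec_lam0 G (e : asg M G) (u : tm (tp0 :: tp0 :: G) tp0) (a : num M) :
  app (app (app (m_Rec M) (eval e (lam (lam u)))) a) (0 : num M) = a.
Proof. exact: (sat_axiom (acons (eval e (lam (lam u))) (asg1 a)) (ax_Rec_0 v0 v1)). Qed.

Lemma rec_lamS G (e : asg M G) (u : tm (tp0 :: tp0 :: G) tp0) (a n : num M) :
  app (app (app (m_Rec M) (eval e (lam (lam u)))) a) (n + 1 : num M) =
  eval (acons (app (app (app (m_Rec M) (eval e (lam (lam u)))) a) n) (acons (n : M tp0) e)) u.
Proof.
rewrite -!eval_lam.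
exact: (sat_axiom (acons (eval e (lam (lam u))) (asg2 a n)) (ax_Rec_S v0 v1 v2)).
Qed.

Lemma num_ind G (A : fm (tp0 :: G)) (e : asg M G) : qf A ->
  sat A (acons (0 : num M) e) ->
  (forall n : num M, sat A (acons n e) -> sat A (acons (n + 1 : num M) e)) ->
  forall n : num M, sat A (acons n e).
Proof. exact: qf_ind. Qed.

Definition predM (x : num M) : num M := eval (asg1 x) (pred0 v0).
Definition monM (x y : num M) : num M := eval (asg2 y x) (monus v1 v0).

Lemma predM0 : predM 0 = 0. Proof. exact: (rec_lam0 (anil (M := M)) v1). Qed.
Lemma predMS n : predM (n + 1) = n. Proof. exact: (rec_lamS (anil (M := M)) v1). Qed.

(** Naming the predecessor by a term keeps the induction formula quantifier-free. *)
Lemma num_case (n : num M) : n = 0 \/ n = predM n + 1.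
Proof.
apply: (num_ind (A := Or (Eq0 v0 Zero) (Eq0 v0 (pred0 v0 + 1)))) => //.
  by left.
by move=> m _; right; change (m + 1 = predM (m + 1) + 1); rewrite predMS.
Qed.
End Semiring.

(** * Arithmetic of pairing and of codes of rationals *)

Local Open Scope ring_scope.

Lemma add_fractions (R : realFieldType) (a b c a' b' c' : R) :
  c + 1 != 0 -> c' + 1 != 0 ->
  (a * (c' + 1) + a' * (c + 1) - (b * (c' + 1) + b' * (c + 1))) / ((c + 1) * (c' + 1)) =
  (a - b) / (c + 1) + (a' - b') / (c' + 1).
Proof. by move=> nc nc'; field; rewrite nc nc'. Qed.

Lemma fraction_lt (R : realFieldType) (a b c a' b' c' : R) : 0 < c -> 0 < c' ->
  ((a - b) / c < (a' - b') / c') = (a * c' + b' * c < a' * c + b * c').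
Proof.
move=> c0 c'0; rewrite ltr_pdivrMr // mulrAC ltr_pdivlMr //.
by apply/idP/idP; lra.
Qed.

Lemma max_add_max (R : realDomainType) (a b : R) :
  Num.max 0 (a - b) + Num.max 0 (b - a) = `|a - b|.
Proof.
have [ab|/ltW ba] := lerP b a.
  by rewrite max_r ?subr_ge0 // max_l ?subr_le0 // addr0.
by rewrite max_l ?subr_le0 // max_r ?subr_ge0 // add0r.
Qed.

Section Arithmetic.
Variable M : rca_model.
Notation asg1 x := (acons (x : M tp0) anil).
Notation asg2 x y := (acons (x : M tp0) (asg1 y)).
Implicit Types x y n : num M.

Lemma monM0 x : monM x 0 = x. Proof. exact: (rec_lam0 (anil (M := M)) (pred0 v0)). Qed.
Lemma monMS x y : monM x (y + 1) = predM (monM x y).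
Proof. exact: (rec_lamS (anil (M := M)) (pred0 v0)). Qed.

Lemma n_lt_succ x : n_lt x (x + 1).
Proof. by have := n_lt_add x (n_lt01 M); rewrite addrC [X in n_lt _ X]addrC addr0. Qed.

(** The second alternative also records the value 0, because the next step of the recursion takes
    its predecessor. *)
Lemma monMP x y : x = monM x y + y \/ n_lt x y /\ monM x y = 0.
Proof.
apply: (num_ind (A := Or (Eq0 v1 (monus v1 v0 + v0))
  (And (Lt0 v1 v0) (Eq0 (monus v1 v0) Zero))) (e := asg1 x)) => // [|{}y].
  by left; change (x = monM x 0 + 0); rewrite addr0 monM0.
change (x = monM x y + y \/ n_lt x y /\ monM x y = 0 ->
  x = monM x (y + 1) + (y + 1) \/ n_lt x (y + 1) /\ monM x (y + 1) = 0).
rewrite monMS; case=> [E|[L ->]]; last first.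
  by right; rewrite predM0; split=> //; apply: n_trans L (n_lt_succ y).
have [m0|mS] := num_case (monM x y).
  right; rewrite m0 predM0; split=> //.
  by rewrite E m0 add0r; apply: n_lt_succ.
by left; rewrite addrC -addrA [1 + _]addrC -mS addrC.
Qed.

Lemma n_succ_pos n : n_lt 0 (n + 1).
Proof.
apply: (num_ind (A := Lt0 Zero (v0 + 1)) (e := anil)) => // [|{}n L].
  by change (n_lt (0 : num M) (0 + 1)); rewrite add0r; apply: n_lt01.
by change (n_lt (0 : num M) (n + 1 + 1)); apply: n_trans L (n_lt_succ _).
Qed.

Lemma n_sub x y : n_lt x y -> exists z, y = x + z + 1.
Proof.
move=> L; have [E|[G _]] := monMP y x; last by have /n_irr := n_trans L G.
have [m0|mS] := num_case (monM y x).
  by have /n_irr : n_lt x x by rewrite {2}(_ : x = y) // E m0 add0r.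
by exists (predM (monM y x)); rewrite {1}E {1}mS; ring.
Qed.

Definition dsM : discrete_semiring := @DiscreteSemiring (num M) (@n_lt M) (@n_irr M)
  (@n_trans M) (@n_total M) (@n_lt_add M) (@n_lt_mul M) n_succ_pos n_sub.

Definition fracM : realFieldType := frac dsM.
Definition emb (x : num M) : fracM := to_frac (x : dsM).

Lemma embD x y : emb (x + y) = emb x + emb y. Proof. exact: to_fracD. Qed.
Lemma embM x y : emb (x * y) = emb x * emb y. Proof. exact: to_fracM. Qed.
Lemma emb0 : emb 0 = 0. Proof. by []. Qed.
Lemma emb1 : emb 1 = 1. Proof. by []. Qed.
Lemma emb_lt x y : n_lt x y <-> emb x < emb y. Proof. exact: (to_frac_lt (N := dsM)). Qed.
Lemma emb_ge0 x : 0 <= emb x. Proof. exact: to_frac_ge0. Qed.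
Lemma emb_inj : injective emb. Proof. exact: to_frac_inj. Qed.
Definition embE := (embD, embM, emb0, emb1).
End Arithmetic.
Opaque fracM emb.

Section Pairing.
Variable M : rca_model.
Notation asg1 x := (acons (x : M tp0) anil).
Notation asg2 x y := (acons (x : M tp0) (asg1 y)).
Implicit Types x y n : num M.

Lemma emb_succ_le x y : emb x < emb y -> emb x + 1 <= emb y.
Proof.
move=> /emb_lt/n_sub[z ->]; rewrite !embE; have := emb_ge0 z; lra.
Qed.

Lemma emb_predM x : x <> 0 -> emb (predM x) + 1 = emb x.
Proof. by move=> x0; have [/x0 //|E] := num_case x; rewrite [in RHS]E !embE. Qed.

Lemma emb_monM x y : emb (monM x y) = Num.max 0 (emb x - emb y).
Proof.
case: (monMP x y) => [{2}->|[/emb_lt L ->]].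
  by rewrite embE addrK max_r ?emb_ge0.
by rewrite max_l //; lra.
Qed.

Lemma monM_eq0 x y : monM x y = 0 <-> emb x <= emb y.
Proof.
split=> [/(congr1 (@emb M))|L]; first by rewrite emb_monM embE; case: (leP 0); lra.
by apply: emb_inj; rewrite emb_monM embE max_l //; lra.
Qed.

Definition ifM (c a b : num M) : num M := if c == 0 then a else b.
Definition exp2M n : num M := eval (asg1 n) (exp2 v0).
Definition triM n : num M := eval (asg1 n) (tri v0).
Definition trM n : num M := eval (asg1 n) (triroot v0).
Definition pairM x y : num M := triM (x + y) + y.
Definition sndM n : num M := monM n (triM (trM n)).
Definition fstM n : num M := monM (trM n) (sndM n).

Section EvalTerms.
Variables (G : ctx) (e : asg M G).
Implicit Types (a b c : tm G tp0).
Lemma eval_zero : eval e Zero = (0 : num M). Proof. by []. Qed.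
Lemma eval_one : eval e One = (1 : num M). Proof. by []. Qed.
Lemma eval_plus a b : eval e (a + b) = (eval e a : num M) + eval e b.
Proof. by []. Qed.
Lemma eval_times a b : eval e (a * b) = (eval e a : num M) * eval e b.
Proof. by []. Qed.
Lemma eval_pred0 a : eval e (pred0 a) = predM (eval e a). Proof. by []. Qed.
Lemma eval_monus a b : eval e (monus a b) = monM (eval e a) (eval e b). Proof. by []. Qed.
Lemma eval_exp2 a : eval e (exp2 a) = exp2M (eval e a). Proof. by []. Qed.
Lemma eval_tri a : eval e (tri a) = triM (eval e a). Proof. by []. Qed.
Lemma eval_triroot a : eval e (triroot a) = trM (eval e a). Proof. by []. Qed.
Lemma eval_pair0 a b : eval e (pair0 a b) = pairM (eval e a) (eval e b). Proof. by []. Qed.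
Lemma eval_snd0 a : eval e (snd0 a) = sndM (eval e a). Proof. by []. Qed.
Lemma eval_fst0 a : eval e (fst0 a) = fstM (eval e a). Proof. by []. Qed.
Lemma eval_ifz c a b : eval e (ifz c a b) = ifM (eval e c) (eval e a) (eval e b).
Proof.
rewrite /ifM; case: eqP => c0.
  by rewrite -(rec_lam0 e (wk (wk b)) (eval e a)) -c0.
have [//|E] := num_case (eval e c : num M).
have := rec_lamS e (wk (wk b)) (eval e a) (predM (eval e c : num M)).
by rewrite -E !eval_wk.
Qed.
End EvalTerms.

Definition evalE := (eval_zero, eval_one, eval_plus, eval_times, eval_pred0, eval_monus,
  eval_exp2, eval_tri, eval_triroot, eval_pair0, eval_snd0, eval_fst0, eval_ifz).

Lemma exp2M0 : exp2M 0 = 1.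
Proof. exact: (rec_lam0 (anil (M := M)) (v0 + v0)). Qed.
Lemma exp2MS n : exp2M (n + 1) = exp2M n + exp2M n.
Proof. exact: (rec_lamS (anil (M := M)) (v0 + v0)). Qed.

Lemma triM0 : triM 0 = 0.
Proof. exact: (rec_lam0 (anil (M := M)) (v0 + (v1 + 1))). Qed.
Lemma triMS n : triM (n + 1) = triM n + (n + 1).
Proof. exact: (rec_lamS (anil (M := M)) (v0 + (v1 + 1))). Qed.

Let triroot_step : tm [:: tp0; tp0] tp0 :=
  ifz (monus (tri (v0 + 1)) (v1 + 1)) (v0 + 1) v0.
Lemma trM0 : trM 0 = 0. Proof. exact: (rec_lam0 (anil (M := M)) triroot_step). Qed.
Lemma trMS n : trM (n + 1) =
  ifM (monM (triM (trM n + 1)) (n + 1)) (trM n + 1) (trM n).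
Proof.
have -> : trM (n + 1) = eval (asg2 (trM n) n) triroot_step.
  exact: (rec_lamS (anil (M := M)) triroot_step).
by rewrite eval_ifz.
Qed.

Lemma exp2M_pos n : 0 < emb (exp2M n).
Proof.
rewrite -emb0; apply/emb_lt; move: n.
apply: (num_ind (A := Lt0 Zero (exp2 v0)) (e := anil)) => // [|n].
  by change (n_lt (0 : num M) (exp2M 0)); rewrite exp2M0; apply: n_lt01.
change (n_lt (0 : num M) (exp2M n) -> n_lt (0 : num M) (exp2M (n + 1))).
by rewrite !emb_lt exp2MS !embE; lra.
Qed.

(** The order of [fracM] is external to the model, so the induction is on the negated strict
    inequality between numbers. *)
Lemma triM_le w d : emb (triM w) <= emb (triM (w + d)).
Proof.
rewrite leNgt; apply/negP => /emb_lt; move: d.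
apply: (num_ind (A := Imp (Lt0 (tri (v1 + v0)) (tri v1)) Bot) (e := asg1 w)) => // [|d].
  change (n_lt (triM (w + 0)) (triM w) -> False); rewrite addr0; exact: n_irr.
change ((n_lt (triM (w + d)) (triM w) -> False) -> n_lt (triM (w + (d + 1))) (triM w) -> False).
rewrite addrA triMS !emb_lt !embE => IH L; apply: IH; move: L.
have := emb_ge0 w; have := emb_ge0 d; lra.
Qed.

Lemma trM_bounds n : emb (triM (trM n)) <= emb n /\ emb n < emb (triM (trM n + 1)).
Proof.
suff [/emb_lt L [/emb_lt G|E]] : n_lt n (triM (trM n + 1)) /\
    (n_lt (triM (trM n)) n \/ triM (trM n) = n)
  by split=> //; first [exact: ltW | rewrite E].
move: n; apply: (num_ind (A := And (Lt0 v0 (tri (triroot v0 + 1)))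
  (Or (Lt0 (tri (triroot v0)) v0) (Eq0 (tri (triroot v0)) v0))) (e := anil)) => // [|n].
  change (n_lt 0 (triM (trM 0 + 1)) /\ (n_lt (triM (trM 0)) 0 \/ triM (trM 0) = 0)).
  by rewrite trM0 triMS triM0 !add0r; split; [apply: n_lt01|right].
change (n_lt n (triM (trM n + 1)) /\ (n_lt (triM (trM n)) n \/ triM (trM n) = n) ->
  n_lt (n + 1) (triM (trM (n + 1) + 1)) /\
  (n_lt (triM (trM (n + 1))) (n + 1) \/ triM (trM (n + 1)) = n + 1)).
move=> [/emb_lt L G]; have {}G : emb (triM (trM n)) <= emb n.
  by case: G => [/emb_lt/ltW|->].
have eq x y : emb x <= emb y -> n_lt x y \/ x = y.
  by rewrite le_eqVlt => /orP[/eqP/emb_inj|/emb_lt]; [right|left].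
rewrite trMS /ifM; case: eqP => [/monM_eq0 H|H].
  split; last exact: eq.
  apply/emb_lt; rewrite (triMS (trM n + 1)) !embE.
  have := emb_succ_le L; have := emb_ge0 (trM n); lra.
have {}H : emb (n + 1) < emb (triM (trM n + 1)).
  by rewrite ltNge; apply/negP => /monM_eq0.
split; first exact/emb_lt.
by left; apply/emb_lt; rewrite !embE; lra.
Qed.

Lemma tri_unique w t n : emb (triM w) <= emb n -> emb n < emb (triM (w + 1)) ->
  emb (triM t) <= emb n -> emb n < emb (triM (t + 1)) -> w = t.
Proof.
have half w' t' : emb (triM t') <= emb n -> emb n < emb (triM (w' + 1)) -> ~ n_lt w' t'.
  move=> L1 L2 /n_sub[z E]; have := triM_le (w' + 1) z.
  by rewrite (_ : w' + 1 + z = t'); [lra|rewrite E; ring].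
move=> a b c d; have [L|[//|L]] := n_total w t; exfalso.
  exact: (half _ _ c b L).
exact: (half _ _ a d L).
Qed.

(** Adding [y], which is at most [x + y], to a triangular number with root [x + y] does not reach
    the next one, so uniqueness identifies the root. *)
Lemma trM_pair x y : trM (pairM x y) = x + y.
Proof.
have [L1 L2] := trM_bounds (pairM x y).
apply: (tri_unique L1 L2); rewrite /pairM ?triMS !embE; have := emb_ge0 x; have := emb_ge0 y; lra.
Qed.

Lemma sndM_pair x y : sndM (pairM x y) = y.
Proof.
apply: emb_inj; rewrite /sndM trM_pair emb_monM /pairM embE addrAC subrr add0r max_r //.
exact: emb_ge0.
Qed.

Lemma fstM_pair x y : fstM (pairM x y) = x.
Proof.
apply: emb_inj; rewrite /fstM sndM_pair trM_pair emb_monM embE addrK max_r //.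
exact: emb_ge0.
Qed.

Definition qval (q : num M) : fracM M :=
  (emb (fstM (fstM q)) - emb (sndM (fstM q))) / (emb (sndM q) + 1).

Lemma qval_mk (a b c : num M) : qval (pairM (pairM a b) c) = (emb a - emb b) / (emb c + 1).
Proof. by rewrite /qval !fstM_pair !sndM_pair. Qed.

Definition dyad (n : num M) : fracM M := (emb (exp2M n))^-1.

Lemma dyad_pos n : 0 < dyad n. Proof. by rewrite invr_gt0 exp2M_pos. Qed.

Lemma dyadS n : dyad (n + 1) = dyad n / 2.
Proof.
rewrite /dyad exp2MS embE; have := exp2M_pos n => p.
by field; apply/andP; split; apply: lt0r_neq0; lra.
Qed.

Lemma emb_pred_den (p q : num M) : emb (predM ((sndM p + 1) * (sndM q + 1))) + 1 =
  (emb (sndM p) + 1) * (emb (sndM q) + 1).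
Proof.
rewrite emb_predM ?embE // => /(congr1 (@emb M)); rewrite !embE.
have := emb_ge0 (sndM p); have := emb_ge0 (sndM q) => a b.
by have: 0 < (emb (sndM p) + 1) * (emb (sndM q) + 1); [nra|lra].
Qed.

End Pairing.
Opaque pred0 monus ifz exp2 tri triroot pair0 snd0 fst0.
Opaque predM monM exp2M triM trM pairM sndM fstM.

(** * Codes of rationals and their values in the field of fractions *)

Section Rationals.
Variable M : rca_model.

Section EvalQ.
Variables (G : ctx) (e : asg M G).
Implicit Types (p q : tm G tp0).

Lemma den_pos (x : num M) : 0 < emb x + 1.
Proof. have := emb_ge0 x; lra. Qed.

Lemma den_neq0 (x : num M) : emb x + 1 != 0.
Proof. by rewrite gt_eqF ?den_pos. Qed.

Lemma qval_ltE (p q : num M) :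
  (emb (fstM (fstM p)) * (emb (sndM q) + 1) + emb (sndM (fstM q)) * (emb (sndM p) + 1) <
   emb (fstM (fstM q)) * (emb (sndM p) + 1) + emb (sndM (fstM p)) * (emb (sndM q) + 1)) =
  (qval p < qval q).
Proof.
by rewrite /qval fraction_lt ?den_pos.
Qed.

Lemma qval_leE (p q : num M) :
  (emb (fstM (fstM p)) * (emb (sndM q) + 1) + emb (sndM (fstM q)) * (emb (sndM p) + 1) <=
   emb (fstM (fstM q)) * (emb (sndM p) + 1) + emb (sndM (fstM p)) * (emb (sndM q) + 1)) =
  (qval p <= qval q).
Proof.
by rewrite leNgt qval_ltE -leNgt.
Qed.

Lemma sat_lt p q : sat (Lt0 p q) e <-> emb (eval e p) < emb (eval e q).
Proof. exact: emb_lt. Qed.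

Lemma sat_le p q : sat (Or (Lt0 p q) (Eq0 p q)) e <-> emb (eval e p) <= emb (eval e q).
Proof.
rewrite le_eqVlt; split; first by case=> [/emb_lt ->|/= ->]; rewrite ?orbT ?eqxx.
by case/orP => [/eqP/emb_inj|/emb_lt]; [right|left].
Qed.

Lemma sat_qlt p q : sat (qlt p q) e <-> qval (eval e p) < qval (eval e q).
Proof. by rewrite sat_lt /qpos /qneg /qden !evalE !embE qval_ltE. Qed.

Lemma sat_qle p q : sat (qle p q) e <-> qval (eval e p) <= qval (eval e q).
Proof. by rewrite sat_le /qpos /qneg /qden !evalE !embE qval_leE. Qed.

Lemma eval_mkq a b c : eval e (mkq a b c) = pairM (pairM (eval e a) (eval e b)) (eval e c).
Proof. by rewrite /mkq !eval_pair0. Qed.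

Lemma qval_qadd p q : qval (eval e (qadd p q)) = qval (eval e p) + qval (eval e q).
Proof.
rewrite eval_mkq qval_mk /qpos /qneg /qden !evalE emb_pred_den /qval.
rewrite !embE; move: (den_neq0 (sndM (eval e p))) (den_neq0 (sndM (eval e q))).
move: (emb _) (emb _) (emb _) (emb _) (emb _) (emb _) => a b c a' b' c' nc nc'.
exact: add_fractions.
Qed.

Lemma qval_qsub p q : qval (eval e (qsub p q)) = qval (eval e p) - qval (eval e q).
Proof.
rewrite /qsub qval_qadd eval_mkq qval_mk /qneg /qpos /qval !evalE.
by rewrite -[in RHS]mulNr opprB.
Qed.

Lemma qval_qabs p : qval (eval e (qabs p)) = `|qval (eval e p)|.
Proof.
rewrite eval_mkq qval_mk /qpos /qneg !evalE embD 2!emb_monM emb0 subr0.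
rewrite /qval normrM normfV [`|_ + 1|]gtr0_norm ?den_pos //; congr (_ / _).
exact: max_add_max.
Qed.

Lemma qval_qexp p : qval (eval e (qexp p)) = dyad (eval e p).
Proof.
rewrite eval_mkq qval_mk eval_pred0 eval_exp2 emb_predM; last first.
  move=> /(congr1 (@emb M)); have := exp2M_pos (eval e p).
  by rewrite emb0 => /[swap] ->; rewrite ltxx.
by rewrite /= emb0 emb1 subr0 div1r.
Qed.

Lemma qval_qexp' p : qval (eval e (qexp' p)) = 2 * dyad (eval e p).
Proof. by rewrite qval_qadd qval_qexp; ring. Qed.

End EvalQ.
End Rationals.

(** * Reals in a model *)

Section Clamp.
Variable R : realFieldType.

Definition clF (v : R) : R := if v <= 0 then 0 else if v <= 1 then v else 1.

Lemma clF_bounds v : 0 <= clF v <= 1.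
Proof. rewrite /clF; case: (lerP v 0) => ?; case: (lerP v 1) => ?; apply/andP; split; lra. Qed.

Lemma clF_dist v w : `|clF v - clF w| <= `|v - w|.
Proof.
move: (ler_norm (v - w)) (ler_norm (- (v - w))); rewrite normrN ler_norml /clF.
move: `|v - w| => t; case: (lerP v 0) => ?; case: (lerP v 1) => ?; case: (lerP w 0) => ?;
  case: (lerP w 1) => ? ? ?; apply/andP; split; lra.
Qed.
End Clamp.

Section Reals.
Variable M : rca_model.
Implicit Types (x y r : M tp1) (n i j : num M).
Notation num := (num M).
Notation q x n := (qval (app (x : M tp1) (n : num))).

Definition is_real y := forall n i, `|q y n - q y (n + i)| < dyad n.
Definition is_rlt x y := exists n, q x n + 2 * dyad n < q y n.
Definition is_rle x y := forall n, q x n <= q y n + 2 * dyad n.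
Definition is_in01 x := is_real x /\
  (forall n, 0 <= q x n + 2 * dyad n) /\ (forall n, q x n <= 1 + 2 * dyad n).

Section Sat.
Variables (G : ctx) (e : asg M G).
Implicit Types (u v : tm G tp1).

Lemma sat_isReal u : sat (isReal u) e <-> is_real (eval e u).
Proof.
by split=> H n i; [have /sat_qlt := H n i|apply/sat_qlt; have := H n i];
  rewrite qval_qabs qval_qsub qval_qexp /= !eval_wk.
Qed.

Lemma sat_rlt u v : sat (rlt u v) e <-> is_rlt (eval e u) (eval e v).
Proof.
by split=> -[n H]; exists n; [move/sat_qlt: H|apply/sat_qlt; move: H];
  rewrite qval_qadd qval_qexp' /= !eval_wk.
Qed.

Lemma sat_rle u v : sat (rle u v) e <-> is_rle (eval e u) (eval e v).
Proof.
by split=> H n; [have /sat_qle := H n|apply/sat_qle; have := H n];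
  rewrite qval_qadd qval_qexp' /= !eval_wk.
Qed.

Lemma qval_radd u v n :
  q (eval e (radd u v)) n = q (eval e u) (n + 1) + q (eval e v) (n + 1).
Proof. by rewrite eval_lam qval_qadd /= !eval_wk. Qed.

Lemma qval_rsub u v n :
  q (eval e (rsub u v)) n = q (eval e u) (n + 1) - q (eval e v) (n + 1).
Proof. by rewrite eval_lam qval_qsub /= !eval_wk. Qed.

Lemma qval_rabs u n : q (eval e (rabs u)) n = `|q (eval e u) n|.
Proof. by rewrite eval_lam qval_qabs /= !eval_wk. Qed.

Lemma qval_mk00 : qval (eval e (mkq 0 0 0)) = 0.
Proof. by rewrite eval_mkq qval_mk !evalE emb0 subrr mul0r. Qed.

Lemma qval_mk10 : qval (eval e (mkq 1 0 0)) = 1.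
Proof. by rewrite eval_mkq qval_mk !evalE emb0 emb1 subr0 add0r divr1. Qed.
End Sat.

Lemma qval_r0 G (e : asg M G) n : q (eval e r0) n = 0.
Proof. by rewrite eval_lam qval_mk00. Qed.

Lemma qval_r1 G (e : asg M G) n : q (eval e r1) n = 1.
Proof. by rewrite eval_lam qval_mk10. Qed.

Lemma sat_in01 G (e : asg M G) u : sat (in01 u) e <-> is_in01 (eval e u).
Proof.
rewrite /in01 -[sat _ e]/(sat (isReal u) e /\ sat (rle r0 u) e /\ sat (rle u r1) e).
rewrite sat_isReal !sat_rle /is_in01.
have -> : is_rle (eval e r0) (eval e u) <-> forall n, 0 <= q (eval e u) n + 2 * dyad n.
  by split=> H n; have := H n; rewrite (qval_r0 e n).
have -> // : is_rle (eval e u) (eval e r1) <-> forall n, q (eval e u) n <= 1 + 2 * dyad n.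
by split=> H n; have := H n; rewrite (qval_r1 e n).
Qed.



Lemma real_dist y a b : is_real y -> `|q y a - q y b| < dyad a + dyad b.
Proof.
have L a' b' : is_real y -> n_lt a' b' -> `|q y a' - q y b'| < dyad a'.
  by move=> ry /n_sub[z ->]; rewrite -addrA; apply: ry.
move=> ry; have pa := dyad_pos a; have pb := dyad_pos b.
have [/L H|[->|/L H]] := n_total a b.
- by apply: lt_trans (H ry) _; rewrite ltrDl.
- by rewrite subrr normr0 addr_gt0.
- by rewrite distrC; apply: lt_trans (H ry) _; rewrite ltrDr.
Qed.

(** * Decidable comparison and clamping of rationals *)

Definition qleb G (a b : tm G tp0) : tm G tp0 :=
  monus (qpos a * qden b + qneg b * qden a)
        (qpos b * qden a + qneg a * qden b).

(** The value 0 stands for truth, as in [ifz]. Strictness is expressed on the cross-multiplied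
    numbers, where [s < t] amounts to [s + 1 <= t]. *)
Definition qltb G (a b : tm G tp0) : tm G tp0 :=
  monus (qpos a * qden b + qneg b * qden a + 1)
        (qpos b * qden a + qneg a * qden b).

Lemma eval_qleb G (e : asg M G) a b :
  (eval e (qleb a b) = (0 : num)) <-> qval (eval e a) <= qval (eval e b).
Proof.
rewrite eval_monus monM_eq0 /qpos /qneg /qden !evalE !embE -qval_leE; exact: iff_refl.
Qed.

Lemma eval_qltb G (e : asg M G) a b :
  (eval e (qltb a b) = (0 : num)) <-> qval (eval e a) < qval (eval e b).
Proof.
rewrite eval_monus monM_eq0 /qpos /qneg /qden !evalE -qval_ltE -!embE.
by split=> [|/emb_succ_le]; rewrite !embE; lra.
Qed.

Lemma ifM_iff (t a b : num) (P : bool) : (t = 0 <-> P) -> ifM t a b = if P then a else b.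
Proof.
by move=> tP; rewrite /ifM; case: eqP => [/tP ->|nt] //; case: ifP => // /tP.
Qed.

Definition clampT G (a : tm G tp0) : tm G tp0 :=
  ifz (qleb a (mkq 0 0 0)) (mkq 0 0 0)
    (ifz (qleb a (mkq 1 0 0)) a (mkq 1 0 0)).
Definition clM (c : num) : num := eval (acons (c : M tp0) anil) (clampT v0).

Lemma eval_clampT G (e : asg M G) a : eval e (clampT a) = clM (eval e a).
Proof. by rewrite /clM /clampT /qleb /mkq /qpos /qneg /qden !evalE. Qed.

Lemma qval_clM c : qval (clM c) = clF (qval c).
Proof.
pose e := acons (c : M tp0) anil.
have E1 : eval e (qleb v0 (mkq 0 0 0)) = (0 : num) <-> qval c <= 0.
  by rewrite eval_qleb qval_mk00.
have E2 : eval e (qleb v0 (mkq 1 0 0)) = (0 : num) <-> qval c <= 1.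
  by rewrite eval_qleb qval_mk10.
rewrite /clM /clampT !eval_ifz (ifM_iff _ _ E1) (ifM_iff _ _ E2) /clF.
by case: ifP => [_|_]; [rewrite qval_mk00|case: ifP => //; rewrite qval_mk10].
Qed.
End Reals.
Opaque mkq qleb qltb clampT clM qadd qsub qabs qexp qexp' qval dyad.

(** * Suprema from monotone convergence *)

(** Convergence speaks about the limit at some index [k + 1], and the estimate is moved to index
    [n]: [t / 2] comes from regularity at [k + 1], and [2 * t] from the margin in [rlt]. *)
Lemma close_trans (R : realFieldType) (x y z s t : R) :
  0 < t -> `|z - y| < s + t / 2 -> `|x - y| + 2 * t < s -> `|x - z| < 4 * s.
Proof.
move=> t0 H1 H2; have := normr_ge0 (x - y); have := ler_distD y x z.
rewrite [`|y - z|]distrC; lra.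
Qed.

Section Net.
Variable M : rca_model.
Notation num := (num M).
Notation q x n := (qval (app (x : M tp1) (n : num))).
Hypothesis MCT : sat MCT0_net (anil (M := M)).
Variable g : M tp2.
Hypothesis g01 : forall f, 0 <= qval (app g f) <= 1.

Let eg : asg M [:: tp2] := acons g anil.
Let Dom : M tp2 := eval eg (lam One).
Let Ord : M (Arr tp1 (Arr tp1 tp0)) :=
  eval eg (lam (lam (ifz (qleb (v2 `@ v1) (v2 `@ v0)) One Zero))).
Let Net : M (Arr tp1 tp1) := eval eg (lam (lam (v2 `@ v1))).

Lemma DomE d : app Dom d = (1 : num). Proof. by rewrite /Dom eval_lam. Qed.
Lemma NetE d n : app (app Net d) n = app g d. Proof. by rewrite /Net !eval_lam. Qed.
Lemma OrdE d e : app (app Ord d) e = (1 : num) <-> qval (app g d) <= qval (app g e).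
Proof.
rewrite /Ord !eval_lam eval_ifz.
have E := eval_qleb (acons e (acons d eg)) (v2 `@ v1) (v2 `@ v0).
rewrite (ifM_iff _ _ E) /=; case: ifP => _; split=> // E01.
by case/eqP: (n1_neq0 M); apply: esym E01.
Qed.
Lemma Ord_le1 d e : emb (app (app Ord d) e : num) <= 1.
Proof.
rewrite /Ord !eval_lam eval_ifz /ifM; case: eqP => _; rewrite evalE embE //.
Qed.

Let e3 : asg M [:: Arr tp1 tp1; Arr tp1 (Arr tp1 tp0); tp2] :=
  acons Net (acons Ord (acons Dom anil)).

Lemma net_ok : sat (net_in01 v2 v1 v0) e3.
Proof.
split; first by move=> d; apply/sat_le; rewrite [eval _ _]DomE.
split; first by move=> d e; apply/sat_le; apply: Ord_le1.
split.
  split; first by exists (eval anil (lam Zero)); apply: DomE.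
  split; first by move=> d _; apply/OrdE.
  split.
    move=> d _ e _ f _ /OrdE de /OrdE ef; apply/OrdE; exact: le_trans de ef.
  move=> d _ e _; have [le|/ltW le] := leP (qval (app g d)) (qval (app g e)).
    by exists e; split; [apply: DomE|split; apply/OrdE].
  by exists d; split; [apply: DomE|split; apply/OrdE].
move=> d _; apply/sat_in01; split; [|split].
- by move=> n i; rewrite !NetE subrr normr0 dyad_pos.
- by move=> n; rewrite NetE; have := g01 d; have := dyad_pos n; lra.
- by move=> n; rewrite NetE; have := g01 d; have := dyad_pos n; lra.
Qed.

Lemma net_increasing : sat (increasing v2 v1 v0) e3.
Proof.
move=> d _ e _ /OrdE de; apply/sat_rle => n; rewrite !NetE.
have := dyad_pos n; move: de => /=; lra.
Qed.

Lemma net_sup : exists y : M tp1, is_real y /\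
  (forall n f, qval (app g f) <= q y n + 4 * dyad n) /\
  (forall n, exists f, q y n < qval (app g f) + 4 * dyad n).
Proof.
have [y [/sat_isReal ry cv]] := MCT net_ok net_increasing.
exists y; split; first exact: ry.
suff H n : exists d, forall f, qval (app g d) <= qval (app g f) ->
    `|qval (app g f) - q y n| < 4 * dyad n.
  clear cv; split=> n; have [d Hd] := H n; clear H.
    (* The order of the net is linear: a value that is not at least that of [d] lies below it, and
       the value at [d] is itself close to the limit. *)
    move=> f; have [/Hd|le] := leP (qval (app g d)) (qval (app g f)).
      by rewrite ltr_norml => /andP[_ L]; rewrite -lerBlDl ltW.
    have := Hd d (lexx _); rewrite ltr_norml => /andP[_ L].
    by rewrite -lerBlDl; apply: ltW; apply: lt_trans L; rewrite ltrD2r.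
  exists d; have := Hd d (lexx _); rewrite ltr_norml => /andP[L _].
  by rewrite -ltrBlDr -ltrBrDl.
have [eps epsE] : exists eps : M tp1, forall k, q eps k = dyad n.
  by exists (eval (acons (n : M tp0) anil) (lam (qexp v1))) => k; rewrite eval_lam qval_qexp.
have reps : is_real eps by move=> k i; rewrite !epsE subrr normr0 dyad_pos.
have pos : sat (rlt r0 v0) (acons eps (acons y e3)).
  (* The margin [2 * dyad k] in [rlt] is half of [dyad n] at [k = n + 2]. *)
  apply/sat_rlt; exists (n + 1 + 1); rewrite qval_r0 epsE !dyadS; have := dyad_pos n; lra.
have seps : sat (isReal v0) (acons eps (acons y e3)) by apply/sat_isReal.
have [d [_ Hd]] := cv eps seps pos.
exists d => f df; have /sat_rlt[k] := Hd f (DomE f) ((OrdE d f).2 df).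
clear Hd cv.
rewrite qval_rabs qval_rsub epsE.
have -> : q (eval (acons f (acons d (acons eps (acons y e3)))) (wk (wk (wk v1)) `@ v0))
    (k + 1) = qval (app g f).
  by rewrite -(NetE f (k + 1)).
rewrite [eval _ (wk _)](_ : _ = y) //.
have := real_dist n (k + 1) ry; rewrite dyadS; have := dyad_pos k.
move: (qval _) (qval _) (qval _) (dyad _) (dyad _) => a b c t s.
exact: close_trans.
Qed.
End Net.

(** * Normalization of sequences to reals in the unit interval *)

Section Normalize.
Variable M : rca_model.
Implicit Types (f y : M tp1) (n i : num M).
Notation num := (num M).
Notation ap f n := (app (f : M tp1) (n : num) : num).
Notation q x n := (qval (app (x : M tp1) (n : num))).

Let tail_tm : tm [:: tp0; tp0; tp1] tp0 :=
  clampT (v2 `@ (v1 + (2 + 1))).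
Let step_tm : tm [:: tp0; tp0; tp1] tp0 :=
  ifz (qltb (qabs (qsub tail_tm v0)) (qexp (v1 + 2)))
    tail_tm v0.
(** A candidate for entry [n + 1] is accepted only within [dyad (n + 2)] of entry [n], and otherwise
    entry [n] is repeated. The shift of [f] by two indices makes every entry of a real pass this
    test. *)
Definition normal : M (Arr tp1 tp1) :=
  eval anil (lam (Rec `@ lam (lam step_tm) `@ clampT (v0 `@ 2))).

Lemma normal0 f : (ap (app normal f) 0) = clM (ap f (1 + 1)).
Proof.
rewrite /normal eval_lam; have := rec_lam0 (acons f anil) step_tm (clM (ap f (1 + 1))).
by move=> <-; rewrite -[clM (ap f (1 + 1))](eval_clampT (acons f anil) (v0 `@ 2)).
Qed.

Lemma normalS f n : (ap (app normal f) (n + 1)) =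
  let c := clM (ap f (n + (1 + 1 + 1))) in
  if `|qval c - q (app normal f) n| < dyad (n + (1 + 1)) then c else (ap (app normal f) n).
Proof.
rewrite /normal eval_lam.
rewrite -[LHS]/(app (app (app (m_Rec M) (eval (acons f anil) (lam (lam step_tm)))) _) _).
rewrite rec_lamS; set r := app (app (app _ _) _) _.
rewrite /step_tm eval_ifz; set e := acons _ _.
have tE : eval e tail_tm = clM (ap f (n + (1 + 1 + 1))) by rewrite /tail_tm eval_clampT.
have E : eval e (qltb (qabs (qsub tail_tm v0)) (qexp (v1 + 2))) = (0 : num) <->
    `|qval (clM (ap f (n + (1 + 1 + 1)))) - qval r| < dyad (n + (1 + 1)).
  by rewrite eval_qltb qval_qabs qval_qsub qval_qexp tE.
by rewrite (ifM_iff _ _ E) tE.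
Qed.

Lemma normal_bounds f n : 0 <= q (app normal f) n <= 1.
Proof.
pose A : fm [:: tp0; tp1] :=
  And (qle (mkq 0 0 0) (v1 `@ v0)) (qle (v1 `@ v0) (mkq 1 0 0)).
have AE (k : num) : sat A (acons (k : M tp0) (acons (app normal f) anil)) <->
    0 <= q (app normal f) k <= 1.
  rewrite /A -[sat _ _]/(sat (qle _ _) _ /\ sat (qle _ _) _) !sat_qle qval_mk00 qval_mk10.
  by split=> [[-> ->]|/andP[]].
apply/AE; move: n; apply: num_ind => [//||n /AE IH]; apply/AE.
  by rewrite normal0 qval_clM clF_bounds.
by rewrite normalS /=; case: ifP => // _; rewrite qval_clM clF_bounds.
Qed.

Lemma normal_step f n : `|q (app normal f) (n + 1) - q (app normal f) n| < dyad n / 4.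
Proof.
rewrite normalS /=; have d : dyad (n + (1 + 1)) = dyad n / 4 by rewrite addrA !dyadS; field.
case: ifP => [|_]; first by rewrite d.
by rewrite subrr normr0; have := dyad_pos n; lra.
Qed.

Lemma normal_real f : is_real (app normal f).
Proof.
move=> n i; set y := app normal f.
(* The summand [dyad (n + i) / 2] bounds all later steps together, which makes the geometric
   estimate inductive. *)
suff H : `|q y (n + i) - q y n| + dyad (n + i) / 2 <= dyad n / 2.
  by rewrite distrC; have := dyad_pos n; have := dyad_pos (n + i); lra.
pose A : fm [:: tp0; tp0; tp1] :=
  qle (qadd (qabs (qsub (v2 `@ (v1 + v0)) (v2 `@ v1))) (qexp (v1 + v0 + 1)))
      (qexp (v1 + 1)).
have AE (k : num) : sat A (acons (k : M tp0) (acons (n : M tp0) (acons y anil))) <->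
    `|q y (n + k) - q y n| + dyad (n + k) / 2 <= dyad n / 2.
  by rewrite sat_qle qval_qadd qval_qabs qval_qsub !qval_qexp -!dyadS.
apply/AE; move: i; apply: num_ind => [//||i /AE IH]; apply/AE.
  by rewrite addr0 subrr normr0 add0r.
have := normal_step f (n + i); rewrite -/y addrA dyadS => S.
have := ler_distD (q y (n + i)) (q y (n + i + 1)) (q y n); lra.
Qed.

Lemma normal_in01 f : is_in01 (app normal f).
Proof.
split; first exact: normal_real.
split=> n; have := normal_bounds f n; have := dyad_pos n; lra.
Qed.

(** Clamping is 1-Lipschitz, so regularity of [y] makes every acceptance test succeed. *)
Lemma normal_id y : is_real y -> forall n, (ap (app normal y) n) = clM (ap y (n + (1 + 1))).
Proof.
move=> ry.
pose A : fm [:: tp0; tp1; tp1] := Eq0 (v1 `@ v0) (clampT (v2 `@ (v0 + 2))).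
have AE (k : num) : sat A (acons (k : M tp0) (acons (app normal y) (acons y anil))) <->
    (ap (app normal y) k) = clM (ap y (k + (1 + 1))).
  by rewrite -[sat _ _]/(eval _ _ = eval _ _) eval_clampT.
move=> n; apply/AE; move: n; apply: num_ind => [//||n /AE IH]; apply/AE.
  by rewrite normal0 add0r.
rewrite normalS IH /= !qval_clM.
have -> : n + (1 + 1 + 1) = n + 1 + (1 + 1) :> num by ring.
case: ifP => // /negP[]; apply: le_lt_trans (clF_dist _ _) _; rewrite distrC.
have -> : n + 1 + (1 + 1) = n + (1 + 1) + 1 :> num by ring.
exact: ry.
Qed.
End Normalize.
Opaque normal.

(** * Chains of balls *)

Section Chains.
Variable M : rca_model.
Implicit Types (h x y : M tp1) (n i j k : num M).
Notation num := (num M).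
Notation ap f n := (app (f : M tp1) (n : num) : num).
Notation q x n := (qval (app (x : M tp1) (n : num))).

Lemma n_ltS i k : n_lt i (k + 1) <-> n_lt i k \/ i = k.
Proof.
rewrite !emb_lt; split=> [L|]; last by case=> [|->]; rewrite embE emb1; lra.
have [|G|/emb_inj] := ltgtP (emb i) (emb k); [by left| |by right].
by exfalso; move: L; have := emb_succ_le G; rewrite embE emb1; lra.
Qed.

(** Layout of a code [h]: position 0 holds the length; row [i], at the positions [pair0 i j + 1],
    holds the right endpoint ([j = 0]), the precision of the link ([j = 1]) and the centre before
    normalization ([j >= 2]). *)
Let raw_tm : tm [:: tp0; tp1; Arr tp1 tp1] tp1 :=
  lam (v2 `@ (pair0 v1 (v0 + 2) + 1)).
Definition points : M (Arr tp1 (Arr tp0 tp1)) :=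
  eval (acons (normal M) anil) (lam (lam (v2 `@ raw_tm))).
Definition raw h i : M tp1 := eval (acons (i : M tp0) (acons h (acons (normal M) anil))) raw_tm.

Lemma rawE h i j : (ap (raw h i) j) = (ap h (pairM i (j + (1 + 1)) + 1)).
Proof. by rewrite /raw /raw_tm eval_lam. Qed.

Lemma pointsE h i : app (app points h) (i : M tp0) = app (normal M) (raw h i).
Proof. by rewrite /points 2!eval_lam. Qed.

(** Endpoint [i + 1] is stored in row [i], hence the predecessor. Clamping makes any stored number
    an admissible endpoint. *)
Definition ends : M (Arr tp1 (Arr tp0 tp0)) :=
  eval anil (lam (lam (ifz v0 (mkq 0 0 0)
    (clampT (v1 `@ (pair0 (pred0 v0) Zero + 1)))))).
Definition endpt h i : num := app (app ends h) (i : M tp0).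

Lemma endpt0 h : qval (endpt h 0) = 0.
Proof. by rewrite /endpt /ends 2!eval_lam eval_ifz /ifM eqxx qval_mk00. Qed.

Lemma endptS h i : endpt h (i + 1) = clM (ap h (pairM i 0 + 1)).
Proof.
rewrite /endpt /ends 2!eval_lam eval_ifz /ifM eval_clampT.
case: eqP => [i0|_]; last by rewrite -[in RHS](predMS i).
by have /n_irr : n_lt (0 : num) 0 by rewrite -{2}i0; apply: n_succ_pos.
Qed.

Lemma endpt_bounds h i : 0 <= qval (endpt h i) <= 1.
Proof.
have [->|->] := num_case i; first by rewrite endpt0 lexx ler01.
by rewrite endptS qval_clM clF_bounds.
Qed.

Lemma chain_extend h (c n : num) y : exists h', [/\ (ap h' 0) = (ap h 0) + 1,
  forall i j, n_lt i (ap h 0) -> (ap h' (pairM i j + 1)) = (ap h (pairM i j + 1)),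
  (ap h' (pairM (ap h 0) 0 + 1)) = c, (ap h' (pairM (ap h 0) 1 + 1)) = n &
  forall j, (ap h' (pairM (ap h 0) (j + (1 + 1)) + 1)) = (ap y j)].
Proof.
pose w : tm [:: tp0; tp1; tp0; tp0; tp1] tp0 := pred0 v0.
pose e : asg M [:: tp1; tp0; tp0; tp1] :=
  acons h (acons (c : M tp0) (acons (n : M tp0) (acons y anil))).
(* Position 0 receives the new length, rows below the old length are copied, and all later rows
   receive the new data; only the first of these lies below the new length. *)
pose t : tm [:: tp0; tp1; tp0; tp0; tp1] tp0 :=
  ifz v0 (v1 `@ 0 + 1)
   (ifz (monus (fst0 w + 1) (v1 `@ 0)) (v1 `@ v0)
    (ifz (snd0 w) v2 (ifz (pred0 (snd0 w)) v3 (v4 `@ pred0 (pred0 (snd0 w)))))).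
have tE i j : (ap (eval e (lam t)) (pairM i j + 1)) =
    if emb (i + 1) <= emb (ap h 0) then (ap h (pairM i j + 1)) else
    ifM j c (ifM (predM j) n (ap y (predM (predM j)))).
  rewrite eval_lam /t /w !eval_ifz !evalE /= !evalE /=.
  rewrite predMS fstM_pair sndM_pair; rewrite {1}/ifM.
  case: eqP => [z0|_].
    by have /n_irr : n_lt (0 : num) 0 by rewrite -{2}z0; apply: n_succ_pos.
  by rewrite (ifM_iff _ _ (monM_eq0 (i + 1) (ap h 0))).
have nk : (emb ((ap h 0) + 1) <= emb (ap h 0)) = false.
  by apply/negbTE; rewrite -ltNge embE emb1; lra.
have nS (m : num) : (m + 1 == 0) = false.
  apply/eqP => z0; have /n_irr // : n_lt (0 : num) 0 by rewrite -{2}z0; apply: n_succ_pos.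
exists (eval e (lam t)); split.
- by rewrite eval_lam /t eval_ifz /ifM eqxx.
- by move=> i j /emb_lt/emb_succ_le L; rewrite tE embE emb1 L.
- by rewrite tE nk /ifM eqxx.
- have p1 : predM (1 : num) = 0 by rewrite -[1]add0r predMS.
  by rewrite tE nk /ifM p1 eqxx oner_eq0.
- by move=> j; rewrite tE nk addrA !predMS /ifM !nS.
Qed.

Variable Psi : M (Arr tp1 tp1).
Definition point h i : M tp1 := app (app points h) (i : M tp0).
Definition radius h i : M tp1 := app Psi (point h i).
Definition prec_of h i : num := (ap h (pairM i 1 + 1)).

(* a certificate, computed with precision [n], that the interval between the
   [i]-th and the next endpoint lies in the [i]-th ball *)
Definition linked h i := let n := prec_of h i in
  q (point h i) n + 8 * dyad n < qval (endpt h i) + q (radius h i) n /\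
  qval (endpt h (i + 1)) + 8 * dyad n < q (point h i) n + q (radius h i) n.

Definition chain h := forall i, n_lt i (ap h 0) -> linked h i.

Definition link_test : M (Arr tp1 (Arr tp0 tp0)) :=
  let n := (v1 `@ (pair0 v0 One + 1))%L in
  let p := (v3 `@ v1 `@ v0)%L in
  let e8 := qadd (qadd (qexp' n) (qexp' n)) (qadd (qexp' n) (qexp' n)) in
  eval (acons Psi (acons points (acons ends anil)))
    (lam (lam (qltb (qadd (p `@ n) e8) (qadd (v4 `@ v1 `@ v0) (v2 `@ p `@ n)) +
               qltb (qadd (v4 `@ v1 `@ (v0 + 1)) e8) (qadd (p `@ n) (v2 `@ p `@ n))))).

Lemma add_eq0 (a b : num) : a + b = 0 <-> a = 0 /\ b = 0.
Proof.
split=> [/(congr1 (@emb M))|[-> ->]]; last by rewrite addr0.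
rewrite embE emb0 => E; have := emb_ge0 a; have := emb_ge0 b.
by split; apply: emb_inj; rewrite emb0; lra.
Qed.

Lemma link_testP h i : app (app link_test h) (i : M tp0) = (0 : num) <-> linked h i.
Proof.
have e8 (t : fracM M) : 2 * t + 2 * t + (2 * t + 2 * t) = 8 * t by ring.
rewrite /link_test 2!eval_lam eval_plus /linked; split.
  move=> /add_eq0[/eval_qltb H1 /eval_qltb H2].
  by rewrite 4!qval_qadd qval_qexp' e8 in H1; rewrite 4!qval_qadd qval_qexp' e8 in H2.
move=> [H1 H2]; apply/add_eq0; split; apply/eval_qltb;
  by rewrite 4!qval_qadd qval_qexp' e8.
Qed.

(** A sum of tests vanishes exactly when all of them succeed; this replaces the bounded quantifier
    in [chain] by one equation, which [ifz] can test. *)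
Definition link_count : M (Arr tp1 (Arr tp0 tp0)) :=
  eval (acons link_test anil)
    (lam (Rec `@ lam (lam (v0 + v3 `@ v2 `@ v1)) `@ 0)).

Lemma link_count0 h : app (app link_count h) (0 : num) = (0 : num).
Proof.
rewrite /link_count eval_lam.
exact: (rec_lam0 (acons h (acons link_test anil)) (v0 + v3 `@ v2 `@ v1)).
Qed.

Lemma link_countS h i : app (app link_count h) (i + 1 : num) =
  (app (app link_count h) (i : M tp0) : num) + app (app link_test h) (i : M tp0).
Proof.
rewrite /link_count eval_lam.
exact: (rec_lamS (acons h (acons link_test anil)) (v0 + v3 `@ v2 `@ v1)).
Qed.

Lemma link_countP h k : app (app link_count h) (k : M tp0) = (0 : num) <->
  forall i, n_lt i k -> linked h i.
Proof.
split=> [+ i|H].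
  (* For this direction [i] is fixed and the induction is on the length. *)
  pose A : fm [:: tp0; tp0; tp1; Arr tp1 (Arr tp0 tp0); Arr tp1 (Arr tp0 tp0)] :=
    Imp (Eq0 (v3 `@ v2 `@ v0) Zero) (Imp (Lt0 v1 v0) (Eq0 (v4 `@ v2 `@ v1) Zero)).
  have AE (m : num) : sat A (acons (m : M tp0) (acons (i : M tp0)
        (acons h (acons link_count (acons link_test anil))))) <->
      (app (app link_count h) (m : M tp0) = (0 : num) -> n_lt i m ->
       app (app link_test h) (i : M tp0) = (0 : num)) by [].
  move=> K L; apply/link_testP; move: K L; apply: (iffLR (AE k)).
  move: k; apply: (num_ind (A := A)) => [//||k /AE IH]; apply/AE.
    by move=> _ /emb_lt L; exfalso; move: L; rewrite emb0; have := emb_ge0 i; lra.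
  by rewrite link_countS => /add_eq0[c0 t0] /n_ltS[|->] //; apply: IH.
(* The hypothesis [H] stays outside the induction formula, which only restricts the counted length
   to at most [k]. *)
pose A : fm [:: tp0; tp0; tp1; Arr tp1 (Arr tp0 tp0)] :=
  Imp (Lt0 v0 (v1 + 1)) (Eq0 (v3 `@ v2 `@ v0) Zero).
have AE (m : num) :
    sat A (acons (m : M tp0) (acons (k : M tp0) (acons h (acons link_count anil)))) <->
    (n_lt m (k + 1) -> app (app link_count h) (m : M tp0) = (0 : num)) by [].
suff Hm m : n_lt m (k + 1) -> app (app link_count h) (m : M tp0) = (0 : num).
  by apply: Hm; apply: n_lt_succ.
apply: (iffLR (AE m)); move: m; apply: (num_ind (A := A)) => [//||m /AE IH]; apply/AE.
  by rewrite link_count0.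
move=> /emb_lt L; rewrite link_countS; apply/add_eq0; split.
  apply: IH; apply/emb_lt; move: L; rewrite !embE; lra.
apply/link_testP; apply: H; apply/emb_lt; move: L; rewrite !embE; lra.
Qed.

(** The default 0 is also what an empty chain reaches, so invalid codes do not raise the
    supremum. *)
Definition reach : M tp2 :=
  eval (acons ends (acons link_count anil))
    (lam (ifz (v2 `@ v0 `@ (v0 `@ 0)) (v1 `@ v0 `@ (v0 `@ 0)) (mkq 0 0 0))).

Lemma reach_chain h : chain h -> qval (app reach h) = qval (endpt h (ap h 0)).
Proof.
move=> /link_countP c; rewrite /reach eval_lam eval_ifz /ifM.
by case: eqP => // n0; case: n0.
Qed.

Lemma reach_nchain h : ~ chain h -> qval (app reach h) = 0.
Proof.
move=> nc; rewrite /reach eval_lam eval_ifz /ifM.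
by case: eqP => [/link_countP|_]; rewrite ?qval_mk00.
Qed.

Lemma reach_bounds h : 0 <= qval (app reach h) <= 1.
Proof.
have [/reach_chain->|/reach_nchain->] := classic (chain h); first exact: endpt_bounds.
by rewrite lexx ler01.
Qed.
End Chains.

(** * The covering theorem *)

Section BallArithmetic.
Variable R : realFieldType.
Implicit Types (Y r l d x t u v : R).

(** Of the margin [8 * d] in a link, [2 * d] pays for the change of index in centre and radius,
    [2 * d] for the imprecise location of [x], and [2 * d] for the margin in [rlt]. *)
Lemma ball_lower Y Y' r r' l d x : Y + 8 * d < l + r -> `|Y - Y'| < d -> `|r - r'| < d ->
  l - 2 * d <= x -> Y' - r' + 2 * d < x.
Proof. rewrite !ltr_norml; lra. Qed.

Lemma ball_upper Y Y' r r' l d x : l + 8 * d < Y + r -> `|Y - Y'| < d -> `|r - r'| < d ->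
  x <= l + 2 * d -> x + 2 * d < Y' + r'.
Proof. rewrite !ltr_norml; lra. Qed.

(** Here [u] and [v] approximate the same point at the precisions [d] and [t] of two consecutive
    links, and [l] is their common endpoint. *)
Lemma locate_step u v l d t : l + 2 * d < u -> 0 < d -> 0 < t -> `|u - v| < d + t ->
  l - 2 * t <= v.
Proof. rewrite !ltr_norml; lra. Qed.

Lemma close_lt u v t : 2 * t < u -> `|u - v| < t -> t < v.
Proof. rewrite !ltr_norml; lra. Qed.

Lemma clF_le (v : R) : 0 <= v -> clF v <= v.
Proof. by move=> v0; rewrite /clF; case: (lerP v 0) => ?; [|case: (lerP v 1) => ?]; lra. Qed.

Lemma clF_lt_eq1 (v : R) : clF v < v -> clF v = 1.
Proof. by rewrite /clF; case: (lerP v 0) => ?; [lra|case: (lerP v 1) => // ?; lra]. Qed.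

(** An approximation [v] of the supremum may leave the unit interval by [4 * d]; the remaining [d]
    is the distance from [w] to [v]. *)
Lemma clF_close (v w d : R) : - (4 * d) <= v -> v <= 1 + 4 * d -> `|w - v| < d ->
  `|clF w - v| < 5 * d.
Proof.
by move=> v0 v1; rewrite !ltr_norml /clF; case: (lerP w 0) => ?; [|case: (lerP w 1) => ?]; lra.
Qed.

Section Snoc.
Variables (p v d t : R).
Hypotheses (dt : d = t / 32) (t0 : 0 < t) (pv : `|p - v| < 5 * d).

Lemma snoc_lower l r : v < l + 4 * d -> t < r -> p + 8 * d < l + r.
Proof. by move: pv t0; rewrite ltr_norml dt; lra. Qed.

Lemma snoc_upper r : 0 <= p -> t < r -> clF (p + t / 2) + 8 * d < p + r.
Proof.
move=> p0; have : clF (p + t / 2) <= p + t / 2 by apply: clF_le; move: t0; lra.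
by move: t0; rewrite dt; lra.
Qed.

(** The shift [t / 2] exceeds the total error [9 * d], so an endpoint that does not pass the
    supremum must have been cut by the clamping. *)
Lemma snoc_full : clF (p + t / 2) <= v + 4 * d -> clF (p + t / 2) = 1.
Proof. by move=> L; apply: clF_lt_eq1; move: pv t0 L; rewrite ltr_norml dt; lra. Qed.
End Snoc.
End BallArithmetic.

(** * Chains that cover the unit interval *)

Section Main.
Variable M : rca_model.
Implicit Types (h x y : M tp1) (n i j k : num M).
Notation num := (num M).
Notation ap f n := (app (f : M tp1) (n : num) : num).
Notation q x n := (qval (app (x : M tp1) (n : num))).

Variable Psi : M (Arr tp1 tp1).
Hypothesis Psi_real : forall y, is_real y -> is_real (app Psi y).

Lemma point_real h i : is_real (point h i).
Proof. by rewrite /point pointsE; apply: normal_real. Qed.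

Lemma radius_real h i : is_real (radius Psi h i).
Proof. exact/Psi_real/point_real. Qed.

(* [i] is least with [x] left of the next endpoint, up to the precision of the
   [i]-th link *)
Lemma chain_locate h x : qval (endpt h (ap h 0)) = 1 -> is_in01 x ->
  exists i, n_lt i (ap h 0) /\
    q x (prec_of h i) <= qval (endpt h (i + 1)) + 2 * dyad (prec_of h i) /\
    qval (endpt h i) - 2 * dyad (prec_of h i) <= q x (prec_of h i).
Proof.
move=> h1 [rx [x0 x1]]; set k := ap h 0 in h1 *.
pose right i := q x (prec_of h i) <= qval (endpt h (i + 1)) + 2 * dyad (prec_of h i).
(* Of minimality only a change from failure to success of [right] is used. If there is none, failure
   propagates from index 0 by quantifier-free induction. *)
have [[i [ik [ri least]]]|none] := classic (exists i, n_lt i k /\ right i /\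
    (i = 0 \/ exists2 j, i = j + 1 & ~ right j)).
  exists i; split; first exact: ik.
  split; first exact: ri.
  case: least => [->|[j -> /negP]]; first by rewrite (endpt0 h) lerBlDr; apply: x0.
  rewrite -ltNge => L.
  exact: locate_step L (dyad_pos _) (dyad_pos _) (real_dist (prec_of h j) (prec_of h (j + 1)) rx).
exfalso.
pose n : tm [:: tp0; tp0; tp1; tp1; Arr tp1 (Arr tp0 tp0)] tp0 :=
  (v2 `@ (pair0 v0 One + 1))%L.
pose A : fm [:: tp0; tp0; tp1; tp1; Arr tp1 (Arr tp0 tp0)] :=
  Imp (Lt0 v0 v1) (Imp (qle (v3 `@ n) (qadd (v4 `@ v2 `@ (v0 + 1)) (qexp' n))) Bot).
have AE (i : num) : sat A (acons (i : M tp0) (acons (k : M tp0)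
      (acons h (acons x (acons (ends M) anil))))) <->
    (n_lt i k -> ~ right i).
  split=> [H L r|H L /sat_qle r]; apply: (H L).
    by apply/sat_qle; rewrite qval_qadd qval_qexp'.
  by rewrite qval_qadd qval_qexp' in r.
have nr i : n_lt i k -> ~ right i.
  apply: (iffLR (AE i)); move: i; apply: (num_ind (A := A)) => [//||i /AE IH]; apply/AE.
    by move=> L r; apply: none; exists 0; split=> //; split=> //; left.
  move=> L r; apply: none; exists (i + 1); split=> //; split=> //; right; exists i => //.
  by apply: IH; apply: n_trans L; apply: n_lt_succ.
(* At the last index the next endpoint is 1, so [right] holds there because [x] is in the unit
   interval. *)
have [k0|kS] := num_case k.
  by move: h1; rewrite k0 endpt0 => /eqP; rewrite eq_sym oner_eq0.
apply: (nr (predM k)); first by rewrite {2}kS; apply: n_lt_succ.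
by rewrite /right -kS h1.
Qed.

Lemma chain_cover h x : chain Psi h -> qval (endpt h (ap h 0)) = 1 -> is_in01 x ->
  exists i n, n_lt i (ap h 0) /\
    q (point h i) (n + 1) - q (radius Psi h i) (n + 1) + 2 * dyad n < q x n /\
    q x n + 2 * dyad n < q (point h i) (n + 1) + q (radius Psi h i) (n + 1).
Proof.
move=> hc h1 x01; have [i [ik [up lo]]] := chain_locate h1 x01.
have [l1 l2] := hc i ik; exists i, (prec_of h i); split; first exact: ik.
have rp := @point_real h i (prec_of h i) 1; have rr := @radius_real h i (prec_of h i) 1.
by split; [apply: ball_lower l1 rp rr lo|apply: ball_upper l2 rp rr up].
Qed.

Hypothesis Psi_pos : forall y, is_real y -> exists n, 2 * dyad n < q (app Psi y) n.
Hypothesis MCT : sat MCT0_net (anil (M := M)).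

Lemma raw_ext h h' i i' : (forall j, ap h (pairM i j + 1) = ap h' (pairM i' j + 1)) ->
  raw h i = raw h' i'.
Proof. by move=> E; apply: app_ext => j; rewrite !rawE E. Qed.

(** Old links survive because they read only rows below the old length; the two inequalities are the
    certificate of the new link at precision [n]. *)
Lemma chain_snoc h (c n : num) y : chain Psi h ->
  q (app (normal M) y) n + 8 * dyad n <
    qval (endpt h (ap h 0)) + q (app Psi (app (normal M) y)) n ->
  clF (qval c) + 8 * dyad n < q (app (normal M) y) n + q (app Psi (app (normal M) y)) n ->
  exists h', chain Psi h' /\ qval (endpt h' (ap h' 0)) = clF (qval c).
Proof.
move=> hc l1 l2; have [h' [k' old cE nE yE]] := chain_extend h c n y.
set k := ap h 0 in hc k' old cE nE yE l1 *.
have endE i : n_lt i (k + 1) -> qval (endpt h' i) = qval (endpt h i).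
  have [->|iS] := num_case i; first by rewrite !endpt0.
  rewrite iS => /emb_lt L; rewrite !endptS old //.
  by apply/emb_lt; move: L; rewrite !embD ltrD2r.
have lastE : qval (endpt h' (k + 1)) = clF (qval c) by rewrite endptS cE qval_clM.
exists h'; split; last by rewrite k' lastE.
move=> i; rewrite k' => /n_ltS[L|->].
  have pE : point h' i = point h i.
    by rewrite /point !pointsE; congr app; apply: raw_ext => j; apply: old.
  have pr : prec_of h' i = prec_of h i := old i 1 L.
  have e1 : qval (endpt h' i) = qval (endpt h i) by apply: endE; apply/n_ltS; left.
  have e2 : qval (endpt h' (i + 1)) = qval (endpt h (i + 1)) by apply: endE; apply: n_lt_add.
  rewrite /linked /radius pE pr e1 e2; exact: hc.
have pE : point h' k = app (normal M) y.
  by rewrite /point pointsE; congr app; apply: app_ext => j; rewrite rawE yE.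
by rewrite /linked /radius pE /prec_of nE lastE endE //; apply: n_lt_succ.
Qed.

Lemma full_chain : exists h, chain Psi h /\ qval (endpt h (ap h 0)) = 1.
Proof.
have [y [ry [ub ap_]]] := net_sup MCT (reach_bounds Psi).
set p := app (normal M) y.
have rp : is_real p := normal_real y.
have [m Pm] := Psi_pos rp; set t := dyad m in Pm.
(* With [d = dyad n], the estimates ask for [17 * d <= t] left of the centre, [t / 2 + 8 * d <= t]
   right of it, and [9 * d <= t / 2] to pass the supremum; [t = 32 * d] is the least power of two
   that suffices. *)
pose n := m + (1 + 1 + 1 + 1 + 1).
have dn : dyad n = t / 32 by rewrite /n !addrA !dyadS -/t; field.
have t0 : 0 < t := dyad_pos m.
(* Positivity gives the bound [2 * t] at index [m]; moving to index [n] loses less than [t]. *)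
have rn : t < q (app Psi p) n := close_lt Pm (Psi_real rp m _).
have y_lo : - (4 * dyad n) <= q y n.
  have /andP[r0_ _] := reach_bounds Psi y.
  by rewrite -subr_ge0 opprK; apply: le_trans r0_ (ub n y).
have y_hi : q y n <= 1 + 4 * dyad n.
  have [f Hf] := ap_ n; have /andP[_ r1_] := reach_bounds Psi f.
  by apply: ltW; apply: lt_le_trans Hf _; rewrite lerD2r.
have py : `|q p n - q y n| < 5 * dyad n.
  rewrite /p normal_id // qval_clM; apply: clF_close => //.
  by rewrite distrC; apply: ry.
have [h [hc hy]] : exists h, chain Psi h /\ q y n < qval (endpt h (ap h 0)) + 4 * dyad n.
  have [f Hf] := ap_ n; have [fc|nfc] := classic (chain Psi f).
    by exists f; rewrite -(reach_chain fc).
  (* An invalid code has value 0, so the empty chain, coded by the zero sequence, comes just as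
     close to the supremum. *)
  rewrite (reach_nchain nfc) in Hf.
  pose z : M tp1 := eval anil (lam Zero).
  have z0 : ap z 0 = 0 by rewrite /z eval_lam.
  exists z; split; last by rewrite z0 endpt0.
  by move=> i; rewrite z0 => /emb_lt L; exfalso; move: L; rewrite emb0 ltNge emb_ge0.
(* Half of the lower bound [t] for the radius carries the new endpoint past the supremum; the other
   half is left for the margin of the link. *)
have [c cE] : exists c : num, qval c = q p n + t / 2.
  exists (eval (acons (ap p n : M tp0) (acons (m + 1 : num) anil)) (qadd v0 (qexp v1))).
  by rewrite qval_qadd qval_qexp /= dyadS.
have p0 : 0 <= q p n by have /andP[] := normal_bounds y n.
have [h' [hc' h'E]] : exists h', chain Psi h' /\ qval (endpt h' (ap h' 0)) = clF (qval c).
  apply: (chain_snoc (n := n) (y := y) hc); rewrite -/p.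
    exact: snoc_lower dn t0 py _ _ hy rn.
  by rewrite cE; apply: snoc_upper.
exists h'; split; first exact: hc'.
by have := ub n h'; rewrite (reach_chain hc') h'E cE; apply: snoc_full dn t0 py.
Qed.
End Main.

Lemma sat_HBU (M : rca_model) : sat MCT0_net (anil (M := M)) -> sat HBU (anil (M := M)).
Proof.
move=> MCT Psi [[real_Psi _] pos_Psi].
have Psi_real y : is_real y -> is_real (app Psi y).
  move=> ry; apply/(sat_isReal (acons y (acons Psi anil)) (wk v0 `@ v0)).
  by apply: real_Psi; apply/sat_isReal.
have Psi_pos y : is_real y -> exists n : num M, 2 * dyad n < qval (app (app Psi y) n).
  move=> ry; have sy : sat (isReal v0) (acons y (acons Psi anil)) by apply/sat_isReal.
  have /sat_rlt[n L] := pos_Psi y sy; exists n; by rewrite qval_r0 add0r in L.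
have [h [hc h1]] := full_chain Psi_real Psi_pos MCT.
(* Length and centres are read off the code; the length is a number of the model. *)
exists (app h (0 : num M)), (app (points M) h); split.
  move=> i _; apply/sat_in01; rewrite [eval _ _]pointsE; exact: normal_in01.
move=> x /sat_in01 x01; have [i [n [ik [lo up]]]] := chain_cover Psi_real hc h1 x01.
exists i; split; first exact: ik.
by split; apply/sat_rlt; exists n; [rewrite qval_rsub; exact: lo|rewrite qval_radd; exact: up].
Qed.

Theorem theorem3p2 : proves (add_axiom RCA0w MCT0_net) HBU.
Proof.
apply: completeness => [B RB|M MT]; first by left.
pose M' := @RCAModel M (fun B RB => MT B (or_introl RB)).
exact: (@sat_HBU M' (MT _ (or_intror erefl))).
Qed.
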